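(* There is an $\aleph_1$-saturated real closed field $K$ such that no integer part of $K$ is a model of Peano Arithmetic.
   Context: A subring $M$ of a real closed field $K$ is an integer part of $K$ if $M$ is discretely ordered (there is no $m\in M$ with $0<m<1$) and for every $x\in K$ there is $m\in M$ with $x\le m<x+1$. An integer part $M$ is said to be a model of Peano Arithmetic (PA) if its set of nonnegative elements $M_{\ge 0}$, as a structure with $+,\cdot,<,0,1$, is a model of PA. Saturation of $K$ is with respect to the language of ordered fields. *)

(* Defs.v *)
From mathcomp Require Import all_boot all_order all_algebra.
From mathcomp Require Import classical_sets cardinality.
From mathcomp Require Import ordered_qelim.

Set Implicit Arguments.
Unset Strict Implicit.
Unset Printing Implicit Defensive.

Import Order.TTheory GRing.Theory Num.Theory.

Local Open Scope ring_scope.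

(** * Saturation in the language of ordered fields *)

Section FormulasWithParameters.
Variable T : eqType.

Fixpoint term_vars (t : GRing.term T) : seq nat :=
  match t with
  | GRing.Var i => [:: i]
  | GRing.Const _ | GRing.NatConst _ => [::]
  | GRing.Add t1 t2 | GRing.Mul t1 t2 => term_vars t1 ++ term_vars t2
  | GRing.Opp t1 | GRing.NatMul t1 _ | GRing.Inv t1 | GRing.Exp t1 _ =>
      term_vars t1
  end.

Fixpoint term_params (t : GRing.term T) : seq T :=
  match t with
  | GRing.Const c => [:: c]
  | GRing.Var _ | GRing.NatConst _ => [::]
  | GRing.Add t1 t2 | GRing.Mul t1 t2 => term_params t1 ++ term_params t2
  | GRing.Opp t1 | GRing.NatMul t1 _ | GRing.Inv t1 | GRing.Exp t1 _ =>
      term_params t1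
  end.

Fixpoint free_vars (f : ord.formula T) : seq nat :=
  match f with
  | ord.Bool _ => [::]
  | ord.Equal t1 t2 | ord.Lt t1 t2 | ord.Le t1 t2 =>
      term_vars t1 ++ term_vars t2
  | ord.Unit t1 => term_vars t1
  | ord.And f1 f2 | ord.Or f1 f2 | ord.Implies f1 f2 =>
      free_vars f1 ++ free_vars f2
  | ord.Not f1 => free_vars f1
  | ord.Exists i f1 | ord.Forall i f1 => [seq j <- free_vars f1 | j != i]
  end.

Fixpoint params (f : ord.formula T) : seq T :=
  match f with
  | ord.Bool _ => [::]
  | ord.Equal t1 t2 | ord.Lt t1 t2 | ord.Le t1 t2 =>
      term_params t1 ++ term_params t2
  | ord.Unit t1 => term_params t1
  | ord.And f1 f2 | ord.Or f1 f2 | ord.Implies f1 f2 => params f1 ++ params f2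
  | ord.Not f1 | ord.Exists _ f1 | ord.Forall _ f1 => params f1
  end.

End FormulasWithParameters.

(* [ord.rformula] excludes the inverse and the unit predicate, leaving
   0, 1, +, -, *, <, <= (and the abbreviations t *+ n, t ^+ n, n%:R); the
   single free variable of a 1-type is 'X_0. *)
Definition formula1_over (K : rcfType) (A : set K) (f : ord.formula K) : Prop :=
  [/\ ord.rformula f,
      forall i, i \in free_vars f -> i = 0%N
    & forall c, c \in params f -> A c].

Definition realizes (K : rcfType) (x : K) (p : set (ord.formula K)) : Prop :=
  forall f, p f -> ord.holds [:: x] f.

Definition finitely_satisfiable (K : rcfType) (p : set (ord.formula K)) : Prop :=
  forall q : set (ord.formula K), finite_set q -> (q `<=` p)%classic ->
    exists x : K, realizes x q.

(* Cardinality less than aleph_1 means countable (finite sets included). *)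
Definition aleph1_saturated (K : rcfType) : Prop :=
  forall (A : set K) (p : set (ord.formula K)),
    countable A ->
    (forall f, p f -> formula1_over A f) ->
    finitely_satisfiable p ->
    exists x : K, realizes x p.

(** * Peano Arithmetic in the language 0, 1, +, *, < *)

Inductive arith_term : Type :=
| AVar of nat
| AZero
| AOne
| AAdd of arith_term & arith_term
| AMul of arith_term & arith_term.

Inductive arith_formula : Type :=
| AEqual of arith_term & arith_term
| ALt of arith_term & arith_term
| ANot of arith_formula
| AAnd of arith_formula & arith_formula
| AOr of arith_formula & arith_formula
| AImplies of arith_formula & arith_formula
| AExists of nat & arith_formula
| AForall of nat & arith_formula.

Record arith_structure : Type := ArithStructure {
  carrier :> Type;
  zero : carrier;
  one : carrier;
  plus : carrier -> carrier -> carrier;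
  times : carrier -> carrier -> carrier;
  less : carrier -> carrier -> Prop }.

Section Satisfaction.
Variable N : arith_structure.

Definition update (e : nat -> N) (i : nat) (x : N) : nat -> N :=
  fun j => if j == i then x else e j.

Fixpoint arith_eval (e : nat -> N) (t : arith_term) : N :=
  match t with
  | AVar i => e i
  | AZero => zero N
  | AOne => one N
  | AAdd t1 t2 => plus (arith_eval e t1) (arith_eval e t2)
  | AMul t1 t2 => times (arith_eval e t1) (arith_eval e t2)
  end.

Fixpoint arith_holds (e : nat -> N) (f : arith_formula) : Prop :=
  match f with
  | AEqual t1 t2 => arith_eval e t1 = arith_eval e t2
  | ALt t1 t2 => less (arith_eval e t1) (arith_eval e t2)
  | ANot f1 => ~ arith_holds e f1
  | AAnd f1 f2 => arith_holds e f1 /\ arith_holds e f2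
  | AOr f1 f2 => arith_holds e f1 \/ arith_holds e f2
  | AImplies f1 f2 => arith_holds e f1 -> arith_holds e f2
  | AExists i f1 => exists x : N, arith_holds (update e i x) f1
  | AForall i f1 => forall x : N, arith_holds (update e i x) f1
  end.

(* Satisfaction of the axioms, unfolded: in the induction scheme, [f] is any
   formula, [i] the induction variable, and [e] gives the values of the other
   free variables, over which the axiom is universally closed. *)
Record model_of_PA : Prop := ModelOfPA {
  PA_succ_neq0 : forall x : N, plus x (one N) <> zero N;
  PA_succ_inj : forall x y : N, plus x (one N) = plus y (one N) -> x = y;
  PA_add0 : forall x : N, plus x (zero N) = x;
  PA_addS : forall x y : N, plus x (plus y (one N)) = plus (plus x y) (one N);
  PA_mul0 : forall x : N, times x (zero N) = zero N;
  PA_mulS : forall x y : N, times x (plus y (one N)) = plus (times x y) x;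
  PA_lt : forall x y : N,
    less x y <-> exists z : N, plus x (plus z (one N)) = y;
  PA_induction : forall (f : arith_formula) (i : nat) (e : nat -> N),
    arith_holds (update e i (zero N)) f ->
    (forall x : N, arith_holds (update e i x) f ->
       arith_holds (update e i (plus x (one N))) f) ->
    forall x : N, arith_holds (update e i x) f }.

End Satisfaction.

(** * Integer parts *)

Definition integer_part (K : rcfType) (M : subringClosed K) : Prop :=
  (forall m : K, m \in M -> ~ (0 < m < 1)) /\
  (forall x : K, exists2 m : K, m \in M & x <= m < x + 1).

Section NonnegativePart.
Variables (K : rcfType) (M : subringClosed K).

Definition nonneg_part : Type := {x : K | (x \in M) && (0 <= x)}.

Lemma nonneg_zero_subproof : (0 \in M) && (0 <= 0 :> K).
Proof. by rewrite rpred0 lexx. Qed.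

Lemma nonneg_one_subproof : (1 \in M) && (0 <= 1 :> K).
Proof. by rewrite rpred1 ler01. Qed.

Lemma nonneg_add_subproof (x y : nonneg_part) :
  (val x + val y \in M) && (0 <= val x + val y).
Proof.
by case: x y => x /= /andP[? ?] [y /= /andP[? ?]]; rewrite rpredD ?addr_ge0.
Qed.

Lemma nonneg_mul_subproof (x y : nonneg_part) :
  (val x * val y \in M) && (0 <= val x * val y).
Proof.
by case: x y => x /= /andP[? ?] [y /= /andP[? ?]]; rewrite rpredM ?mulr_ge0.
Qed.

Definition nonneg_structure : arith_structure :=
  @ArithStructure nonneg_part
    (exist _ 0 nonneg_zero_subproof)
    (exist _ 1 nonneg_one_subproof)
    (fun x y => exist _ (val x + val y) (nonneg_add_subproof x y))
    (fun x y => exist _ (val x * val y) (nonneg_mul_subproof x y))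
    (fun x y => val x < val y).

End NonnegativePart.

(* Main.v *)
(* A model [M] of PA that is an integer part of [K] lets one exponentiate
   inside [K]: for infinite [a] in [M], the solutions of the Pell equation
   x^2 - (a^2 - 1) y^2 = 1 grow like the powers of [a], and [y] is congruent to
   its index modulo [a - 1], so "[y] is a solution of index [m]" is arithmetical.
   By overspill, a family coinitial among the infinite elements of [K] then
   yields, with the same index set, a family coinitial in {x | a^n < x for all
   n}. It is thus enough to find an aleph_1-saturated real closed field in which
   the coinitialities of these two sets differ.

   Let [L] be the union of a long chain of ultrapowers over the natural numbers,
   and [F0] its first term. Take [K] maximal among the subfields of [L] that
   contain [F0] and have no element between the natural numbers and the infinite
   elements of [F0]; the latter are then coinitial among the infinite elements
   of [K]. If z is in [L] but not in [K], then by maximality K(z) contains an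
   element [u] of that forbidden gap; comparing Archimedean classes gives
   z = c + g u or z = c + g / u with c, g in [K]. So the cut of z in [K] looks
   like that of [u] (or its mirror image): it is never countable on both sides,
   whence saturation by quantifier elimination, and it is never the cut just
   above the powers of an infinite [a], so the coinitiality of that cut is as
   large as in [L]. *)
Require Import Defs.
From HB Require Import structures.
From mathcomp Require Import all_boot all_order all_algebra.
From mathcomp Require Import ring lra.
From mathcomp Require Import boolp wochoice classical_sets cardinality filter.
From mathcomp Require Import polyrcf ordered_qelim realalg.
From mathcomp Require qe_rcf complex.

Set Implicit Arguments.
Unset Strict Implicit.
Unset Printing Implicit Defensive.

Import Order.TTheory GRing.Theory Num.Theory.

Local Open Scope classical_set_scope.
Local Open Scope ring_scope.

(** * Long well-orders *)

Lemma exists_strict_well_order (T : eqType) : exists lt : T -> T -> Prop,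
  [/\ well_founded lt, forall x y z, lt x y -> lt y z -> lt x z
    & forall x y, [\/ lt x y, x = y | lt y x]].
Proof.
have [R Rwo] := well_ordering_principle T.
have wc : wo_chain R predT by move=> A _; exact: Rwo.
have anti x y : R x y -> R y x -> x = y.
  by move=> xy yx; apply: (wo_chain_antisymmetric wc) => //; rewrite xy.
have total x y : R x y || R y x by exact: (wo_chainW wc).
have refl x : R x x by exact: (wo_chain_reflexive wc).
exists (fun x y => R x y && (x != y)); split.
- move=> x; apply: contrapT => nAx.
  have [|m [[/asboolP nAm minm] _]] :=
      Rwo (fun y => `[< ~ Acc (fun x y => R x y && (x != y)) y >]).
    by exists x; apply/asboolP.
  case: nAm; constructor=> y /andP[Rym neq]; apply: contrapT => nAy.
  by rewrite (anti y m) ?eqxx // in neq; apply: minm; apply/asboolP.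
- move=> x y z /andP[xy nxy] /andP[yz nyz].
  have nxz : x != z.
    by apply: contra nxy => /eqP xz; subst z; rewrite (anti x y).
  rewrite nxz andbT.
  (* Transitivity is read off the least of the three points. *)
  have [|m [[+ minm] _]] := Rwo (mem [:: x; y; z]).
    by exists x; exact: mem_head.
  have mx := minm x; have my := minm y; have mz := minm z.
  rewrite !inE !eqxx ?orbT in mx my mz.
  rewrite !inE => /or3P[] /eqP e; rewrite e in mx my mz; first exact: mz.
    by case/negP: nxy; rewrite (anti x y) // mx.
  by case/negP: nyz; rewrite (anti y z) // my.
- move=> x y; have [->|nxy] := eqVneq x y; first exact: Or32.
  have /orP[h|h] := total x y; first by apply: Or31; rewrite h.
  by apply: Or33; rewrite h.
Qed.

(* The points whose initial segments are images of [I] form an initial segment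
   of a well-order on the power set of [I]; by Cantor's theorem it is not
   itself an image of [I]. *)
Lemma exists_long_well_order (I : Type) (p0 : I -> bool) (p1 p2 : I -> I) :
  inhabited I ->
  (forall b i j, exists l, [/\ p0 l = b, p1 l = i & p2 l = j]) ->
  exists (La : Type) (lt : La -> La -> Prop),
  [/\ well_founded lt, forall x y z, lt x y -> lt y z -> lt x z,
      forall x y, [\/ lt x y, x = y | lt y x],
      forall g : I -> La, exists a, forall i, lt (g i) a
    & inhabited La].
Proof.
move=> [i0] pair.
have [lt [wf tr tri]] := exists_strict_well_order (I -> Prop).
pose cov a :=
  exists g : I -> (I -> Prop), forall x, lt x a -> exists i, g i = x.
have nocov (g : I -> (I -> Prop)) : ~ (forall x, cov x -> exists i, g i = x).
  move=> hg; have allcov : forall x, cov x.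
    elim/(well_founded_ind wf) => x IH.
    by exists g => y yx; apply: hg; exact: IH.
  have [i] := hg (fun i => ~ g i i) (allcov _).
  move=> /(congr1 (fun f => f i)) => e.
  have : (g i i <-> ~ g i i) by rewrite -e.
  by tauto.
exists {x | cov x}, (fun x y => lt (sval x) (sval y)); split.
- move=> [x cx]; elim/(well_founded_ind wf): x cx => x IH cx.
  by constructor=> -[y cy] /= yx; exact: IH.
- by move=> x y z; exact: tr.
- move=> [x cx] [y cy] /=; have [h|e|h] := tri x y;
    [exact: Or31| |exact: Or33].
  by apply: Or32; exact: eq_exist.
- move=> g; apply: contrapT => hn.
  have hb x : cov x -> exists i, x = sval (g i) \/ lt x (sval (g i)).
    move=> cx; apply: contrapT => hx; apply: hn; exists (exist _ x cx) => i /=.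
    have [//|e|h] := tri (sval (g i)) x; case: hx; exists i; first by left.
    by right.
  have /choice[h hh] : forall i, exists h : I -> (I -> Prop),
      forall x, lt x (sval (g i)) -> exists j, h j = x.
    by move=> i; exact: (svalP (g i)).
  (* If no point dominated the family, each covered point would be some [g i] or lie below one and
     be listed by [h i]. A bit and two indices packed in [l] would then enumerate them all. *)
  apply: (@nocov (fun l => if p0 l then sval (g (p1 l)) else h (p1 l) (p2 l))).
  move=> x cx; have [i [->|/hh[j hj]]] := hb x cx.
    by have [l [e0 e1 _]] := pair true i i; exists l; rewrite e0 e1.
  by have [l [e0 e1 e2]] := pair false i j; exists l; rewrite e0 e1 e2.
- apply: contrapT => hn; apply: (@nocov (fun _ _ => True)) => x cx.
  by case: hn; constructor; exists x.
Qed.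

(** * Iterated ultrapowers of the natural numbers *)

Lemma exists_nonprincipal_ultrafilter :
  exists U : set_system nat,
    UltraFilter U /\ forall m, U [set n | (m <= n)%N].
Proof.
have [U [UU leU]] := @ultraFilterLemma nat \oo eventually_filter.
by exists U; split => // m; apply: leU; exists m.
Qed.

Section IteratedUltrapower.
Variables (La : Type) (lt : La -> La -> Prop).
Hypothesis lt_wf : well_founded lt.
Hypothesis lt_trans : forall x y z, lt x y -> lt y z -> lt x z.
Hypothesis lt_total : forall x y, [\/ lt x y, x = y | lt y x].
Variables (U : set_system nat) (UU : UltraFilter U).

Let J := La -> nat.

(* A function on [J] is adapted below [a] when it is computed by querying
   finitely many coordinates, in decreasing order starting below [a]; the
   number of queries is finite on each branch only, since each query may depend
   on the previous answers. *)
Inductive adapted (T : Type) : La -> (J -> T) -> Prop :=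
| adapted_const a c : adapted a (fun=> c)
| adapted_query a b (g : nat -> J -> T) :
    lt b a -> (forall n, adapted b (g n)) -> adapted a (fun x => g (x b) x).

(* The iterated quantifier "for [U]-almost all values of the coordinate", the
   largest coordinate being the outermost one. *)
Inductive large : La -> set J -> Prop :=
| large_all a P : (forall x, P x) -> large a P
| large_query a b P A : lt b a -> U A ->
    (forall n, A n -> large b (fun x => x b = n -> P x)) -> large a P.

Lemma adapted_mono T a b (f : J -> T) : lt a b -> adapted a f -> adapted b f.
Proof.
move=> ab hf; case: a f / hf ab => [a c|a c g ca hg] ab.
  exact: adapted_const.
by apply: adapted_query hg; exact: lt_trans ab.
Qed.

Lemma adapted_comp T T' (h : T -> T') a f :
  adapted a f -> adapted a (fun x => h (f x)).
Proof.
elim=> {a f} [a c|a b g ba _ IH]; first exact: adapted_const.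
exact: (adapted_query (g := fun n x => h (g n x))).
Qed.

(** Induction on the bound: the larger of the two first coordinates is queried first, and the other
    function waits until its own coordinate is reached. *)
Lemma adapted_pair T T' a (f : J -> T) (g : J -> T') :
  adapted a f -> adapted a g -> adapted a (fun x => (f x, g x)).
Proof.
elim/(well_founded_ind lt_wf): a f g => a IH f g hf.
case: a f / hf IH => [a c|a b f ba hf] IH hg.
  exact: (adapted_comp (fun y => (c, y))).
case: a g / hg IH ba => [a c|a b' g b'a hg] IH ba.
  by apply: (adapted_comp (fun y => (y, c))); exact: adapted_query hf.
have [bb'|e|b'b] := lt_total b b'.
- apply: (adapted_query (g := fun n x => (f (x b) x, g n x)) b'a) => n.
  by apply: IH => //; exact: adapted_query hf.
- subst b'; apply: (adapted_query (g := fun n x => (f n x, g n x)) ba) => n.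
  exact: IH.
- apply: (adapted_query (g := fun n x => (f n x, g (x b') x)) ba) => n.
  by apply: IH => //; exact: adapted_query hg.
Qed.

Lemma adapted_comp2 T T' T'' (h : T -> T' -> T'') a f g :
  adapted a f -> adapted a g -> adapted a (fun x => h (f x) (g x)).
Proof.
move=> hf hg.
exact: (adapted_comp (fun y => h y.1 y.2) (adapted_pair hf hg)).
Qed.

Lemma large_sub a P Q : P `<=` Q -> large a P -> large a Q.
Proof.
move=> + hP; elim: hP Q => {a P} [a P hP|a b P A ba UA _ IH] Q PQ.
  by apply: large_all => x; exact: PQ.
apply: (large_query ba UA) => n An; apply: (IH n An) => x xP e.
by apply: PQ; exact: xP.
Qed.

Lemma large_mono a b P : lt a b -> large a P -> large b P.
Proof.
move=> ab hP; case: a P / hP ab => [a P hP|a c P A ca UA hA] ab.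
  exact: large_all.
by apply: large_query UA hA; exact: lt_trans ab.
Qed.

(** Same interleaving as in [adapted_pair]; when both sides query the same coordinate, the two sets
    of the ultrafilter are intersected. *)
Lemma largeI a P Q : large a P -> large a Q -> large a (P `&` Q).
Proof.
elim/(well_founded_ind lt_wf): a P Q => a IH P Q hP.
case: a P / hP IH => [a P hP|a b P A ba UA hP] IH hQ.
  by apply: large_sub hQ => x Qx; split.
case: a Q / hQ IH ba => [a Q hQ|a b' Q B b'a UB hQ] IH ba.
  by apply: (large_sub (P := P)) => [x Px|]; [split|exact: large_query hP].
have [bb'|e|b'b] := lt_total b b'.
- apply: (large_query b'a UB) => n Bn.
  have := IH _ b'a P _ (large_query bb' UA hP) (hQ n Bn).
  by apply: large_sub => x [Px Qx] /Qx.
- subst b'; apply: (large_query ba (filterI UA UB)) => n [An Bn].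
  have := IH _ ba _ _ (hP n An) (hQ n Bn).
  by apply: large_sub => x [Px Qx] e; split; [exact: Px|exact: Qx].
- apply: (large_query ba UA) => n An.
  have := IH _ ba _ Q (hP n An) (large_query b'b UB hQ).
  by apply: large_sub => x [Px Qx] /Px.
Qed.

Lemma large_ex a P : large a P -> exists x, P x.
Proof.
(* The point has to agree with a prescribed [x0] off the coordinates below [a], lest later choices
   overwrite the answer already chosen for [b]. *)
move=> hP; suff /(_ (fun=> 0%N)) [x []] : forall x0 : J,
    exists x, P x /\ forall c, ~ lt c a -> x c = x0 c by exists x.
elim: hP => {a P} [a P hP|a b P A ba UA _ IH] x0; first by exists x0.
have [n An] := filter_ex UA.
have irr c : ~ lt c c.
  by elim/(well_founded_ind lt_wf): c => c IHc h; exact: (IHc c h h).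
have [x [Px xx0]] := IH n An (fun c => if pselect (c = b) then n else x0 c).
exists x; split=> [|c ca].
  by apply: Px; rewrite xx0; [case: pselect|exact: irr].
rewrite xx0; first by case: pselect => // e; subst c; case: ca.
by move=> cb; case: ca; exact: lt_trans ba.
Qed.

(** The dichotomy of [U] is lifted query by query: either almost all answers lead to a large set, or
    almost all lead to a large complement. *)
Lemma large_or a (p : J -> Prop) :
  adapted a p -> large a p \/ large a (~` (p : set J)).
Proof.
elim=> {a p} [a c|a b g ba _ IH].
  by have [hc|hc] := pselect c; [left|right]; exact: large_all.
have [UA|UA] := in_ultra_setVsetC [set n | large b (g n)] UU; [left|right];
  apply: (large_query ba UA) => n.
  by move=> hn; apply: large_sub hn => x gx e; rewrite /setC /= e.
by have [//|hn] := IH n => _; apply: large_sub hn => x gx e; rewrite /setC /= e.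
Qed.

End IteratedUltrapower.

(** * Reduced powers of real closed fields *)

Section ReducedPower.
Variables (J : Type) (k : rcfType).
Variables (D : set (J -> k)) (F : set_system J).
Hypothesis FF : ProperFilter F.
Hypothesis D_fun : forall (h : seq k -> k) (fs : seq (J -> k)),
  (forall f, f \in fs -> D f) -> D (fun j => h [seq f j | f <- fs]).
Hypothesis D_dec : forall f, D f ->
  F [set j | f j = 0] \/ F [set j | f j <> 0].

Let D_cst c : D (fun=> c).
Proof. by apply: (@D_fun (fun=> c) [::]). Qed.

Let D_map (h : k -> k) f : D f -> D (fun j => h (f j)).
Proof.
move=> Df; apply: (@D_fun (fun s => h s`_0) [:: f]) => g.
by rewrite inE => /eqP ->.
Qed.

Let D_map2 (h : k -> k -> k) f g : D f -> D g -> D (fun j => h (f j) (g j)).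
Proof.
move=> Df Dg.
apply: (@D_fun (fun s => h s`_0 s`_1) [:: f; g]) => g'.
by rewrite !inE => /orP[] /eqP ->.
Qed.

Let T := {f : J -> k | `[< D f >]}.

Let eqF (f g : T) := `[< F [set j | val f j = val g j] >].

Let eqF_refl : reflexive eqF.
Proof. by move=> f; apply/asboolP; apply: filterE. Qed.

Let eqF_sym : symmetric eqF.
Proof.
by move=> f g; apply/asboolP/asboolP; apply: filterS => j /= ->.
Qed.

Let eqF_trans : transitive eqF.
Proof.
move=> g f h /asboolP fg /asboolP gh; apply/asboolP.
by apply: filterS2 fg gh => j /= -> ->.
Qed.

Let eqF_equiv := EquivRel eqF eqF_refl eqF_sym eqF_trans.

Let Q : Type := {eq_quot eqF_equiv}%qT.

HB.instance Definition _ := Choice.copy Q {eq_quot eqF_equiv}%qT.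

Let cst0 : T := exist _ (fun=> 0) (asboolT (D_cst 0)).

Let pi (f : J -> k) : Q := (\pi_{eq_quot eqF_equiv} (insubd cst0 f))%qT.

Let rp (x : Q) : J -> k := val (repr (x : {eq_quot eqF_equiv}%qT)).

Let D_rp x : D (rp x).
Proof. by apply/asboolP; exact: (valP (repr (x : {eq_quot eqF_equiv}%qT))). Qed.

Let val_insubd f : D f -> val (insubd cst0 f) = f.
Proof. by move=> Df; rewrite insubdK //; apply/asboolP. Qed.

Let pi_rp x : pi (rp x) = x.
Proof.
rewrite /pi /rp valKd; exact: reprK.
Qed.

Let pi_eq f g : D f -> D g -> pi f = pi g <-> F [set j | f j = g j].
Proof.
move=> Df Dg; split.
  by move=> /eqmodP /asboolP; rewrite !val_insubd.
by move=> fg; apply/eqmodP/asboolP; rewrite !val_insubd.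
Qed.

Let rp_pi f : D f -> F [set j | rp (pi f) j = f j].
Proof. by move=> Df; apply/pi_eq => //; exact: pi_rp. Qed.

Let piW (P : Q -> Prop) : (forall f, D f -> P (pi f)) -> forall x, P x.
Proof. by move=> h x; rewrite -(pi_rp x); apply: h. Qed.

Let add x y := pi (fun j => rp x j + rp y j).
Let mul x y := pi (fun j => rp x j * rp y j).
Let opp x := pi (fun j => - rp x j).
Let inv x := pi (fun j => (rp x j)^-1).

Let piD f g : D f -> D g -> add (pi f) (pi g) = pi (fun j => f j + g j).
Proof.
move=> Df Dg; apply/pi_eq; try exact: (D_map2 (+%R)).
by apply: filterS2 (rp_pi Df) (rp_pi Dg) => j /= -> ->.
Qed.

Let piM f g : D f -> D g -> mul (pi f) (pi g) = pi (fun j => f j * g j).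
Proof.
move=> Df Dg; apply/pi_eq; try exact: (D_map2 (@GRing.mul k)).
by apply: filterS2 (rp_pi Df) (rp_pi Dg) => j /= -> ->.
Qed.

Let piN f : D f -> opp (pi f) = pi (fun j => - f j).
Proof.
move=> Df; apply/pi_eq; try exact: (D_map (-%R)).
by apply: filterS (rp_pi Df) => j /= ->.
Qed.

Let piV f : D f -> inv (pi f) = pi (fun j => (f j)^-1).
Proof.
move=> Df; apply/pi_eq; try exact: (D_map (GRing.inv)).
by apply: filterS (rp_pi Df) => j /= ->.
Qed.

Let DD f g : D f -> D g -> D (fun j => f j + g j).
Proof. exact: D_map2. Qed.
Let DM f g : D f -> D g -> D (fun j => f j * g j).
Proof. exact: D_map2. Qed.
Let DN f : D f -> D (fun j => - f j).
Proof. exact: (D_map (-%R)). Qed.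
Let DV f : D f -> D (fun j => (f j)^-1).
Proof. exact: (D_map (GRing.inv)). Qed.

Let addA : associative add.
Proof.
elim/piW => f Df; elim/piW => g Dg; elim/piW => h Dh.
rewrite !piD //; try exact: DD.
by congr pi; apply: funext => j; exact: addrA.
Qed.

Let addC : commutative add.
Proof.
elim/piW => f Df; elim/piW => g Dg.
rewrite !piD //; congr pi; apply: funext => j; exact: addrC.
Qed.

Let add0 : left_id (pi (fun=> 0)) add.
Proof.
elim/piW => f Df; rewrite piD //; congr pi; apply: funext => j; exact: add0r.
Qed.

Let addN : left_inverse (pi (fun=> 0)) opp add.
Proof.
elim/piW => f Df; rewrite piN // piD //; last exact: DN.
congr pi; apply: funext => j; exact: addNr.
Qed.

Let mulA : associative mul.
Proof.
elim/piW => f Df; elim/piW => g Dg; elim/piW => h Dh.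
rewrite !piM //; try exact: DM.
by congr pi; apply: funext => j; exact: mulrA.
Qed.

Let mulC : commutative mul.
Proof.
elim/piW => f Df; elim/piW => g Dg.
rewrite !piM //; congr pi; apply: funext => j; exact: mulrC.
Qed.

Let mul1 : left_id (pi (fun=> 1)) mul.
Proof.
elim/piW => f Df; rewrite piM //; congr pi; apply: funext => j; exact: mul1r.
Qed.

Let mulD : left_distributive mul add.
Proof.
elim/piW => f Df; elim/piW => g Dg; elim/piW => h Dh.
have Dfg := DD Df Dg; have Dfh := DM Df Dh; have Dgh := DM Dg Dh.
rewrite piD // !piM // piD //; congr pi; apply: funext => j; exact: mulrDl.
Qed.

HB.instance Definition _ := GRing.isZmodule.Build Q addA addC add0 addN.

Let one_neq0 : pi (fun=> 1) != 0 :> Q.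
Proof.
apply/eqP => /pi_eq -/(_ (D_cst 1) (D_cst 0)) h.
by have [j /= /eqP] := filter_ex h; rewrite oner_eq0.
Qed.

HB.instance Definition _ :=
  GRing.Zmodule_isComNzRing.Build Q mulA mulC mul1 mulD one_neq0.

Let mulV (x : Q) : x != 0 -> inv x * x = 1.
Proof.
elim/piW: x => f Df nz; rewrite piV //; have DVf := DV Df.
rewrite [LHS]piM //; apply/pi_eq => //; first exact: DM.
have [h|] := D_dec Df; first by case/eqP: nz; apply/pi_eq.
by apply: filterS => j /eqP; exact: mulVf.
Qed.

Let inv0 : inv (0 : Q) = 0.
Proof.
by rewrite piV //; congr pi; apply: funext => j; rewrite invr0.
Qed.

HB.instance Definition _ := GRing.ComNzRing_isField.Build Q mulV inv0.

Let le (x y : Q) := `[< F [set j | rp x j <= rp y j] >].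
Let lt (x y : Q) := (y != x) && le x y.
Let nrm (x : Q) := pi (fun j => `|rp x j|).

Let pi_le f g : D f -> D g -> le (pi f) (pi g) <-> F [set j | f j <= g j].
Proof.
move=> Df Dg; split.
  by move/asboolP; apply: filterS3 (rp_pi Df) (rp_pi Dg) => j /= -> ->.
by move=> h; apply/asboolP; apply: filterS3 (rp_pi Df) (rp_pi Dg) h => j /= -> ->.
Qed.

Let dec2 (r : rel k) f g : D f -> D g ->
  F [set j | r (f j) (g j)] \/ F [set j | ~~ r (f j) (g j)].
Proof.
move=> Df Dg.
(* [D_dec] decides zero sets only, so the relation is replaced by a function vanishing exactly where
   it holds. *)
have := D_dec (D_map2 (fun x y => if r x y then 0 else 1) Df Dg).
case=> h; [left|right]; apply: filterS h => j /=; case: ifP => // _ /eqP;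
  by rewrite ?oner_eq0 ?eqxx.
Qed.

Let le0_add (x y : Q) : le 0 x -> le 0 y -> le 0 (x + y).
Proof.
elim/piW: x => f Df; elim/piW: y => g Dg.
rewrite [_ + _]piD // => /pi_le -/(_ (D_cst 0) Df) hf /pi_le -/(_ (D_cst 0) Dg) hg.
apply/pi_le => //; first exact: DD.
by apply: filterS2 hf hg => j; exact: addr_ge0.
Qed.

Let le0_mul (x y : Q) : le 0 x -> le 0 y -> le 0 (x * y).
Proof.
elim/piW: x => f Df; elim/piW: y => g Dg.
rewrite [_ * _]piM // => /pi_le -/(_ (D_cst 0) Df) hf /pi_le -/(_ (D_cst 0) Dg) hg.
apply/pi_le => //; first exact: DM.
by apply: filterS2 hf hg => j; exact: mulr_ge0.
Qed.

Let le0_anti (x : Q) : le 0 x -> le x 0 -> x = 0.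
Proof.
elim/piW: x => f Df /pi_le -/(_ (D_cst 0) Df) h1 /pi_le -/(_ Df (D_cst 0)) h2.
apply/pi_eq => //; apply: filterS2 h1 h2 => j h1 h2.
by apply/eqP; rewrite eq_le h1 h2.
Qed.

Let subge0 (x y : Q) : le 0 (y - x) = le x y.
Proof.
elim/piW: x => f Df; elim/piW: y => g Dg.
have DNf := DN Df; have Dgf := DD Dg DNf.
rewrite [- _]piN // [_ + _]piD //; apply/idP/idP => /pi_le h; apply/pi_le => //.
  by apply: filterS (h (D_cst 0) Dgf) => j; rewrite /= subr_ge0.
by apply: filterS (h Df Dg) => j; rewrite /= subr_ge0.
Qed.

Let le0_total (x : Q) : le 0 x || le x 0.
Proof.
elim/piW: x => f Df; have [h|h] := dec2 <=%R (D_cst 0) Df; apply/orP.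
  by left; apply/pi_le.
right; apply/pi_le => //; apply: filterS h => j /=.
by rewrite -ltNge => /ltW.
Qed.

Let nrmN (x : Q) : nrm (- x) = nrm x.
Proof.
elim/piW: x => f Df; have DNf := DN Df; rewrite [- _]piN //.
apply/pi_eq; try exact: (D_map (Num.norm)).
by apply: filterS2 (rp_pi Df) (rp_pi DNf) => j /= -> ->; rewrite normrN.
Qed.

Let ge0_nrm (x : Q) : le 0 x -> nrm x = x.
Proof.
elim/piW: x => f Df /pi_le -/(_ (D_cst 0) Df) h.
apply/pi_eq => //; first exact: (D_map (Num.norm)).
by apply: filterS2 (rp_pi Df) h => j /= -> /ger0_norm.
Qed.

Let lt_def (x y : Q) : lt x y = (y != x) && le x y. Proof. by []. Qed.

HB.instance Definition _ := Num.IntegralDomain_isLeReal.Build Q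
  le0_add le0_mul le0_anti subge0 le0_total nrmN ge0_nrm lt_def.

Let repr_horner (p : {poly Q}) (x : Q) :
  F [set j | rp p.[x] j = (Poly [seq rp c j | c <- p]).[rp x j]].
Proof.
rewrite -[in p.[x]](polyseqK p); elim: (p : seq Q) => [|c s IH] /=.
  by rewrite horner0; apply: filterS (rp_pi (D_cst 0)) => j /= -> /=; rewrite horner0.
rewrite cons_poly_def hornerMXaddC.
have h1 := rp_pi (DD (D_rp ((Poly s).[x] * x)) (D_rp c)).
have h2 := rp_pi (DM (D_rp (Poly s).[x]) (D_rp x)).
apply: filterS3 IH h1 h2 => j /= e h1 h2.
by rewrite cons_poly_def hornerMXaddC -e -h2 -h1.
Qed.

(** Choosing a root between two bounds depends on finitely many values, so [D_fun] keeps the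
    pointwise choice inside [D]. *)
Let root_in (s : seq k) : k :=
  match s with
  | a :: b :: c => xget 0 [set y | a <= y <= b /\ root (Poly c) y]
  | _ => 0
  end.

Let closed : Num.real_closed_axiom Q.
Proof.
move=> p a b leab /andP[pa pb].
pose gx j :=
  root_in [seq f j | f <- [:: rp a, rp b & [seq rp c | c <- p]]].
have Dx : D gx.
  apply: D_fun => f; rewrite !inE => /or3P[/eqP->|/eqP->|/mapP[c _ ->]];
    exact: D_rp.
pose x := pi gx.
have leP (u v : Q) : u <= v -> F [set j | rp u j <= rp v j] by move/asboolP.
have key : F [set j | rp a j <= rp x j <= rp b j
                      /\ root (Poly [seq rp c j | c <- p]) (rp x j)].
  have h1 := leP _ _ leab; have h2 := leP _ _ pa; have h3 := leP _ _ pb.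
  have h0 := rp_pi (D_cst 0).
  apply: filterS3 (filterI h1 h2) (filterI h3 h0)
    (filterI (repr_horner p a) (filterI (repr_horner p b) (rp_pi Dx))).
  move=> j [h1' h2'] [h3' h0'] [ha [hb hx]].
  rewrite /= -/x in hx; rewrite /= hx /gx /= -map_comp.
  have [||y yab ry] := @poly_ivt _ (Poly [seq rp c j | c <- p]) (rp a j) (rp b j).
  - by [].
  - by rewrite -ha -hb -h0' h2' h3'.
  case: xgetP => [y' _ [//]|/(_ y)[]]; split=> //.
exists x.
  by apply/andP; split; apply/asboolP; apply: filterS key => j [/andP[]].
apply/rootP; rewrite -[LHS]pi_rp; apply/pi_eq => //.
by apply: filterS2 key (repr_horner p x) => j /= [_ /rootP r] ->.
Qed.

HB.instance Definition _ := Num.RealField_isClosed.Build Q closed.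

Lemma reduced_power_rcf : exists (L : rcfType) (p : (J -> k) -> L),
  [/\ forall x, exists2 f, D f & p f = x,
      forall f g, D f -> D g -> p (fun j => f j - g j) = p f - p g,
      forall f g, D f -> D g -> p (fun j => f j / g j) = p f / p g,
      p (fun=> 1) = 1
    & forall f g, D f -> D g -> (p f <= p g) <-> F [set j | f j <= g j]].
Proof.
exists (Q : rcfType), pi; split=> //.
- by move=> x; exists (rp x) => //; exact: pi_rp.
- by move=> f g Df Dg; rewrite [- _]piN // [RHS]piD //; exact: DN.
- by move=> f g Df Dg; rewrite [_^-1]piV // [RHS]piM //; exact: DV.
Qed.

End ReducedPower.

(** * The field L *)

Definition infinitely_large (R : numDomainType) (x : R) :=
  forall n : nat, n%:R < x.

Definition subfield_set (R : fieldType) (S : set R) :=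
  [/\ S 1, forall x y, S x -> S y -> S (x - y)
    & forall x y, S x -> S y -> S (x / y)].

(* [F0] plays the role of a small subfield: it has at most as many elements as
   [I], whereas no [I]-indexed family is coinitial above an increasing
   sequence. *)
Definition filling (I : Type) (L : rcfType) (F0 : set L) :=
  [/\ subfield_set F0,
      exists s : I -> L, forall x, F0 x -> exists i, s i = x,
      forall b : nat -> L, (forall n, F0 (b n) /\ infinitely_large (b n)) ->
        exists c, [/\ F0 c, infinitely_large c & forall n, c <= b n],
      forall b, F0 b -> F0 (Num.sqrt b) &
      (exists2 a, F0 a & infinitely_large a) /\
      forall (x : nat -> L) (y : I -> L), {homo x : m n / (m <= n)%N >-> m <= n} ->
        (forall n i, x n < y i) -> exists z, forall n i, x n <= z /\ z < y i].

Section FillingField.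
Variables (k : rcfType) (La : Type) (lt : La -> La -> Prop).
Let I := nat -> k.
Hypothesis lt_wf : well_founded lt.
Hypothesis lt_trans : forall x y z, lt x y -> lt y z -> lt x z.
Hypothesis lt_total : forall x y, [\/ lt x y, x = y | lt y x].
Hypothesis lt_bounded : forall g : I -> La, exists a, forall i, lt (g i) a.
Variable o : La.
Variables (U : set_system nat) (UU : UltraFilter U).
Hypothesis U_large : forall m, U [set n | (m <= n)%N].

Let J := La -> nat.
Let D (f : J -> k) := exists a, adapted lt a f.
Let F : set_system J := [set P | exists a, large lt U a P].

Let bounded2 a b : exists c, lt a c /\ lt b c.
Proof.
have [c hc] := lt_bounded (fun i : I => if i 0%N == 0 then a else b).
exists c; split; first by have := hc (fun=> 0); rewrite eqxx.
by have := hc (fun=> 1); rewrite oner_eq0.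
Qed.

Let bounded_nat (g : nat -> La) : exists a, forall n, lt (g n) a.
Proof.
(* [I] consists of functions; the index [n] is represented by those whose value at 0 is [n%:R]. *)
have [a ha] := lt_bounded (fun i => g (xget 0%N [set n | i 0%N = n%:R])).
exists a => n; have := ha (fun=> n%:R).
by case: xgetP => [m _ /eqP|/(_ n)[] //]; rewrite eqr_nat => /eqP <-.
Qed.

Let F_filter : ProperFilter F.
Proof.
apply: Build_ProperFilter_ex.
  by move=> P [a /(large_ex lt_wf lt_trans UU)].
split.
- by exists o; exact: large_all.
- move=> P Q [a Pa] [b Qb]; have [c [ac bc]] := bounded2 a b; exists c.
  by apply: (largeI lt_wf lt_total UU); exact: large_mono Pa || exact: large_mono Qb.
- by move=> P Q PQ [a Pa]; exists a; exact: large_sub Pa.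
Qed.

#[local] Existing Instance F_filter.

Let adapted_seq (fs : seq (J -> k)) : (forall f, f \in fs -> D f) ->
  exists a, adapted lt a (fun j => [seq f j | f <- fs]).
Proof.
elim: fs => [|f fs IH] h; first by exists o; exact: adapted_const.
have [|a ha] := IH; first by move=> g gfs; apply: h; rewrite inE gfs orbT.
have [b hb] := h f (mem_head _ _); have [c [ac bc]] := bounded2 a b.
exists c; apply: (adapted_comp2 lt_wf lt_total cons).
  exact: adapted_mono hb.
exact: adapted_mono ha.
Qed.

Let D_fun (h : seq k -> k) (fs : seq (J -> k)) :
  (forall f, f \in fs -> D f) -> D (fun j => h [seq f j | f <- fs]).
Proof.
by move=> /adapted_seq[a ha]; exists a; exact: adapted_comp ha.
Qed.

Let D_dec f : D f -> F [set j | f j = 0] \/ F [set j | f j <> 0].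
Proof.
move=> [a ha].
have [h|h] := large_or UU (adapted_comp (fun y => y = 0) ha).
  by left; exists a.
by right; exists a.
Qed.

Let F_at a (p : J -> Prop) : adapted lt a p -> F p -> large lt U a p.
Proof.
move=> ap Fp; have [//|h] := large_or UU ap.
by have [j []] := filter_ex (filterI Fp (ex_intro _ a h : F (~` (p : set J)))).
Qed.

Let F_coord (p : nat -> Prop) : F [set j | p (j o)] <-> U p.
Proof.
have coord q : U q -> F [set j | q (j o)].
  move=> Uq; have [a [oa _]] := bounded2 o o; exists a.
  apply: (large_query oa Uq) => n qn; apply: large_all => j /= e.
  by rewrite e.
split=> [h|]; last exact: coord.
have [//|/coord h'] := in_ultra_setVsetC p UU.
by have [j []] := filter_ex (filterI h h').
Qed.

(** [F0] is the ultrapower of [k] along the single coordinate [o], so functions [nat -> k] enumerate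
    it. A diagonal bounds sequences of its infinite elements from below, and cuts of [L] are filled
    by means of a coordinate not yet queried. *)
Lemma exists_filling_of_well_order : exists (L : rcfType) (F0 : set L), filling I F0.
Proof.
have [L [p [p_surj pB pV p1 p_le]]] := reduced_power_rcf F_filter D_fun D_dec.
have D_comp (h : k -> k) f : D f -> D (fun j => h (f j)).
  by move=> [a ha]; exists a; exact: adapted_comp ha.
have p_eq f g : D f -> D g -> F [set j | f j = g j] -> p f = p g.
  move=> Df Dg h; apply: le_anti; apply/andP; split; apply/p_le => //;
    by apply: filterS h => j /= ->.
have p_lt f g : D f -> D g -> p f < p g <-> F [set j | f j < g j].
  move=> Df Dg; rewrite ltNge; split=> [h|h].
    have [[a ha] [b hb]] := (Df, Dg); have [c [ac bc]] := bounded2 a b.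
    have hc := adapted_comp2 lt_wf lt_total (fun u v => u <= v : Prop)
      (adapted_mono lt_trans bc hb) (adapted_mono lt_trans ac ha).
    have [h'|h'] := large_or UU hc.
      by case/negP: h; apply/p_le => //; exists c.
    by exists c; apply: large_sub h' => j /= /negP; rewrite -ltNge.
  apply/negP => /p_le -/(_ Dg Df) h'.
  by have [j /= []] := filter_ex (filterI h h'); rewrite ltNge => /negP.
have [a0 [oa0 _]] := bounded2 o o.
pose ev (g : nat -> k) (j : J) := g (j o).
have D_ev g : D (ev g).
  by exists a0; apply: (adapted_query (g := fun n _ => g n) oa0) => n; exact: adapted_const.
have D_cst c : D (fun=> c) by exists o; exact: adapted_const.
have p0 : p (fun=> 0) = 0.
  rewrite -[RHS](subrr (1 : L)) -p1 -pB //; congr p; apply: funext => j; by rewrite subrr.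
have pN f : D f -> p (fun j => - f j) = - p f.
  by move=> Df; rewrite -[RHS]sub0r -p0 -pB //; congr p; apply: funext => j; rewrite sub0r.
have pD f g : D f -> D g -> p (fun j => f j + g j) = p f + p g.
  move=> Df Dg; rewrite -[p g]opprK -pN // -pB //; last exact: (D_comp (-%R)).
  by congr p; apply: funext => j; rewrite opprK.
have pI f : D f -> p (fun j => (f j)^-1) = (p f)^-1.
  by move=> Df; rewrite -[RHS]div1r -p1 -pV //; congr p; apply: funext => j; rewrite div1r.
have pM f g : D f -> D g -> p (fun j => f j * g j) = p f * p g.
  move=> Df Dg; rewrite -[p g]invrK -pI // -pV //; last exact: (D_comp GRing.inv).
  by congr p; apply: funext => j; rewrite invrK.
have p_nat n : p (fun=> n%:R) = n%:R.
  elim: n => // n IH; rewrite -[in RHS]natr1 -IH -p1 -pD //; congr p.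
  by apply: funext => j; rewrite natr1.
have inf_ev g : infinitely_large (p (ev g)) <-> forall n, U [set m | n%:R < g m].
  split=> h n.
    apply/F_coord; apply: (proj1 (p_lt _ _ (D_cst n%:R) (D_ev g))).
    by rewrite p_nat; exact: h.
  rewrite -p_nat; apply/(p_lt _ _ (D_cst n%:R) (D_ev g)).
  exact: (proj2 (F_coord (fun m => n%:R < g m)) (h n)).
exists L, [set x | exists g, p (ev g) = x]; split.
- split; first by exists (fun=> 1).
    by move=> _ _ [f <-] [g <-]; exists (fun n => f n - g n); rewrite -pB.
  by move=> _ _ [f <-] [g <-]; exists (fun n => f n / g n); rewrite -pV.
- by exists (fun g => p (ev g)) => x [g <-]; exists g.
- move=> b hb; have /choice[g hg] : forall n, exists g, p (ev g) = b n.
    by move=> n; have [] := hb n.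
  have Ug n m : U [set l | m%:R < g n l].
    by move: m; apply/inf_ev; rewrite hg; have [] := hb n.
  pose Q m n := forall i, (i <= m)%N -> m%:R < g i n.
  have UQ m : U [set n | Q m n].
    have : forall l, U [set n | forall i, (i < l)%N -> m%:R < g i n].
      elim=> [|l IH]; first exact: filterE.
      apply: filterS2 IH (Ug l m) => n /= h1 h2 i.
      by rewrite ltnS leq_eqVlt => /orP[/eqP ->//|]; exact: h1.
    move=> /(_ m.+1); apply: filterS => n h i im; exact: h.
  (* The diagonal: [cn n] is the largest [m <= n] such that [g 0], ..., [g m] all exceed [m] at [n],
     or 0 if there is none. It tends to infinity along [U], yet is almost everywhere below each
     given [g i]. *)
  pose cn n := \max_(m < n.+1 | `[< Q m n >]) m.
  have cn_ge m n : (m <= n)%N -> Q m n -> (m <= cn n)%N.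
    move=> mn Qmn; have mn' : (m < n.+1)%N by [].
    apply: (@leq_bigmax_cond _ (fun m : 'I_n.+1 => `[< Q m n >]) (fun m => m : nat) (Ordinal mn')).
    exact/asboolP.
  have cnQ n : (0 < cn n)%N -> Q (cn n) n.
    move=> c0; rewrite /cn; have [/eqP|c1] := posnP #|[pred m : 'I_n.+1 | `[< Q m n >]]|.
      rewrite -leqn0 leqNgt => /negP nc; exfalso.
      move: c0; rewrite /cn big_pred0 // => m; apply/negP => Qm.
      apply: nc; apply/card_gt0P; exists m; exact: Qm.
    have [m Qm ->] := eq_bigmax_cond (fun m : 'I_n.+1 => m : nat) c1.
    by move: Qm => /asboolP.
  have Ucn m : U [set n | (m <= cn n)%N].
    by apply: filterS2 (U_large m) (UQ m) => n; exact: cn_ge.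
  exists (p (ev (fun n => (cn n)%:R))); split; first by exists (fun n => (cn n)%:R).
    by apply/inf_ev => n; apply: filterS (Ucn n.+1) => m /=; rewrite ltr_nat.
  move=> n; rewrite -hg; apply/p_le => //; apply/(F_coord (fun m => (cn m)%:R <= g n m)).
  apply: filterS (Ucn n.+1) => m /= ncm; apply/ltW/cnQ; last exact: ltnW.
  exact: leq_ltn_trans ncm.
- move=> _ [g <-]; exists (fun n => Num.sqrt (g n)).
  have Ds := D_comp Num.sqrt _ (D_ev g).
  have -> : ev (fun n => Num.sqrt (g n)) = fun j => Num.sqrt (ev g j) by [].
  have s0 : 0 <= p (fun j => Num.sqrt (ev g j)).
    by rewrite -p0; apply/p_le => //; apply: filterE => j; exact: sqrtr_ge0.
  have [g0|g0] := leP 0 (p (ev g)).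
    rewrite -[LHS](ger0_norm s0) -sqrtr_sqr expr2 -pM //; congr Num.sqrt.
    move: g0; rewrite -p0 => /p_le h; apply: p_eq => //.
      by apply: (D_comp (fun x => Num.sqrt x * Num.sqrt x)).
    by apply: filterS (h (D_cst 0) (D_ev g)) => j /= h'; rewrite -expr2 sqr_sqrtr.
  rewrite [RHS]ler0_sqrtr ?(ltW g0) // -p0; apply: p_eq => //.
  move: g0; rewrite -p0 => /p_lt h.
  by apply: filterS (h (D_ev g) (D_cst 0)) => j /= /ltW; exact: ler0_sqrtr.
- split.
    exists (p (ev (fun n => n%:R))); first by exists (fun n => n%:R).
    by apply/inf_ev => n; apply: filterS (U_large n.+1) => m /=; rewrite ltr_nat.
  move=> x y xmono xy.
  have /choice[f hf] : forall n, exists f, D f /\ p f = x n.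
    by move=> n; have [f] := p_surj (x n); exists f.
  have /choice[g hg] : forall i, exists f, D f /\ p f = y i.
    by move=> i; have [g] := p_surj (y i); exists g.
  have /choice[al hal] : forall n, exists a, adapted lt a (f n) by move=> n; case: (hf n).
  have /choice[be hbe] : forall n, exists a, adapted lt a (g n) by move=> n; case: (hg n).
  have [a1 ha1] := bounded_nat al; have [a2 ha2] := lt_bounded be.
  have [c [a1c a2c]] := bounded2 a1 a2; have [d [cd _]] := bounded2 c c.
  have hf' n : adapted lt c (f n).
    by apply: adapted_mono (hal n) => //; exact: lt_trans (ha1 n) a1c.
  have hg' i : adapted lt c (g i).
    by apply: adapted_mono (hbe i) => //; exact: lt_trans (ha2 i) a2c.
  (* The coordinate [c] lies above all those queried by the [f n] and [g i], and its value selects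
     which [f n] to use. Almost all values are at least a given [n], so monotonicity puts the result
     above [x n], while every branch stays below [y i]. *)
  have Dz : D (fun j => f (j c) j) by exists d; exact: adapted_query hf'.
  exists (p (fun j => f (j c) j)) => n i; split.
    have [Dfn <-] := hf n; apply/p_le => //; exists d.
    apply: (large_query cd (U_large n)) => m /= nm.
    apply: (large_sub (P := [set j | f n j <= f m j])) => [j h /= -> //|].
    apply: F_at; first exact:
      (adapted_comp2 lt_wf lt_total (fun u v => u <= v : Prop) (hf' n) (hf' m)).
    by apply/p_le; rewrite ?(proj1 (hf _)) ?(proj2 (hf _)); [case: (hf n)|case: (hf m)|exact: xmono].
  have [Dgi <-] := hg i; apply/p_lt => //; exists d.
  apply: (large_query cd filterT) => m _.
  apply: (large_sub (P := [set j | f m j < g i j])) => [j h /= -> //|].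
  apply: F_at; first exact:
    (adapted_comp2 lt_wf lt_total (fun u v => u < v : Prop) (hf' m) (hg' i)).
  have [Dfm em] := hf m.
  by apply/p_lt => //; rewrite em (proj2 (hg i)).
Qed.

End FillingField.

Lemma exists_filling_rcf (k : rcfType) :
  exists (L : rcfType) (F0 : set L), filling (nat -> k) F0.
Proof.
have [||La [lt [wf tr tot bnd [o]]]] := @exists_long_well_order (nat -> k)
  (fun l => l 0%N == 1) (fun l n => l n.*2.+1) (fun l n => l n.*2.+2).
- by constructor; exact: (fun=> 0).
- move=> b i j.
  (* The bit sits at 0; behind it the two sequences are interleaved. *)
  exists (fun n => if n is n'.+1 then (if odd n' then j n'./2 else i n'./2)
                   else b%:R); split.
  + by case: b; rewrite ?eqxx // eq_sym oner_eq0.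
  + by apply: funext => n /=; rewrite odd_double doubleK.
  + by apply: funext => n /=; rewrite odd_double /= uphalf_double.
have [U [UU UL]] := exists_nonprincipal_ultrafilter.
exact: (exists_filling_of_well_order wf tr tot bnd o UU UL).
Qed.

(** * Subfields, and squares of real polynomials *)

Section SubfieldType.
Variables (L : rcfType) (S : set L).
Hypothesis subS : subfield_set S.

Let Sp : pred L := fun x => `[< S x >].

Let Sp_divring : divring_closed Sp.
Proof.
have [S1 SB SV] := subS.
split; first exact/asboolP.
  by move=> x y /asboolP Sx /asboolP Sy; apply/asboolP; exact: SB.
by move=> x y /asboolP Sx /asboolP Sy; apply/asboolP; exact: SV.
Qed.

HB.instance Definition _ := GRing.isDivringClosed.Build L Sp Sp_divring.

Let K : Type := {x : L | Sp x}.

HB.instance Definition _ := SubChoice.on K.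
HB.instance Definition _ := [SubChoice_isSubIntegralDomain of K by <:].
HB.instance Definition _ := [SubIntegralDomain_isSubField of K by <:].

Let le (x y : K) := val x <= val y.
Let lt (x y : K) := val x < val y.
Let nrm (x : K) : K := if 0 <= val x then x else - x.

Let le0_add (x y : K) : le 0 x -> le 0 y -> le 0 (x + y).
Proof. by rewrite /le rmorph0 rmorphD; exact: addr_ge0. Qed.
Let le0_mul (x y : K) : le 0 x -> le 0 y -> le 0 (x * y).
Proof. by rewrite /le rmorph0 rmorphM; exact: mulr_ge0. Qed.
Let le0_anti (x : K) : le 0 x -> le x 0 -> x = 0.
Proof.
rewrite /le => h1 h2; apply: val_inj; apply/eqP.
by rewrite eq_le h2 h1.
Qed.
Let subge0 (x y : K) : le 0 (y - x) = le x y.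
Proof. by rewrite /le rmorph0 rmorphB subr_ge0. Qed.
Let le0_total (x : K) : le 0 x || le x 0.
Proof. exact: le_total. Qed.
Let nrmN (x : K) : nrm (- x) = nrm x.
Proof.
rewrite /nrm rmorphN oppr_ge0; have [h|h] := leP (val x) 0; last first.
  by rewrite (ltW h) opprK.
case: (leP 0 (val x)) => // h'; apply: val_inj.
have e : val x = 0 by apply/eqP; rewrite eq_le h h'.
by rewrite rmorphN /= e oppr0.
Qed.
Let ge0_nrm (x : K) : le 0 x -> nrm x = x.
Proof. by rewrite /le /nrm rmorph0 => ->. Qed.
Let lt_def (x y : K) : lt x y = (y != x) && le x y.
Proof. by rewrite /lt /le lt_def (inj_eq val_inj). Qed.

HB.instance Definition _ := Num.IntegralDomain_isLeReal.Build K
  le0_add le0_mul le0_anti subge0 le0_total nrmN ge0_nrm lt_def.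

Lemma subfield_type : exists (K' : realFieldType) (v : {rmorphism K' -> L}),
  [/\ forall x, S (v x), forall y, S y -> exists x, v x = y
    & {mono v : x y / x <= y}].
Proof.
exists (K : realFieldType), (val : {rmorphism K -> L}); split=> //.
- by move=> x; apply/asboolP; exact: (valP x).
- by move=> y Sy; exists (exist _ y (asboolT Sy)).
Qed.

End SubfieldType.

Section SquarePolynomial.
Import complex.

(** Over [K(i)] the polynomial splits and equals its own conjugate; multiplying the two
    factorisations pairs each root [z] with its conjugate, and the pair gives a sum of two
    squares. *)
Lemma sqr_poly_rcf (K : rcfType) (p : {poly K}) : exists (c : K) (rs : seq (K * K)),
  p ^+ 2 = c%:P * \prod_(r <- rs) (('X - r.1%:P) ^+ 2 + (r.2 ^+ 2)%:P).
Proof.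
pose toC : {rmorphism K -> complex K} := @real_complex_def K (Phant K).
have toC_inj : injective (map_poly toC) by exact/map_inj_poly/rmorph0/fmorph_inj.
have [s ps] := closed_field_poly_normal (map_poly toC p).
exists (lead_coef p ^+ 2), [seq (complex.Re z, complex.Im z) | z <- s].
apply: toC_inj; rewrite rmorphXn /= rmorphM /= map_polyC /= big_map rmorph_prod /=.
have conj_p : map_poly (@conjc K) (map_poly toC p) = map_poly toC p.
  rewrite -map_poly_comp; apply: eq_map_poly => x /=.
  by rewrite /toC /= /real_complex_def oppr0.
have e : map_poly toC p = (toC (lead_coef p))%:P * \prod_(z <- s) ('X - z%:P).
  by rewrite {1}ps lead_coef_map mul_polyC.
rewrite expr2 -{2}conj_p {1 2}e !rmorphM /= map_polyC /= rmorph_prod /=.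
rewrite mulrACA -big_split /=; congr (_ * _).
  by rewrite oppr0 -polyCM.
apply: eq_bigr => -[a b] _ /=; rewrite map_polyXsubC.
rewrite rmorphD /= rmorphXn /= map_polyXsubC map_polyC /=.
have -> : Complex a b = toC a + Complex 0 b by rewrite /toC /=; simpc.
have -> : Complex a (- b) = toC a - Complex 0 b.
  by rewrite /toC /=; simpc.
have -> : real_complex K (b ^+ 2) = - (Complex 0 b) ^+ 2.
  by rewrite expr2 /real_complex_def; simpc.
rewrite !(polyCD, polyCN) rmorphXn /= opprD opprB.
by rewrite [RHS]subr_sqr !addrA [in X in _ * X]addrAC.
Qed.

End SquarePolynomial.

(** * Archimedean classes *)

Lemma infinitely_large_le (R : numDomainType) (x y : R) :
  infinitely_large x -> x <= y -> infinitely_large y.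
Proof. by move=> hx xy n; exact: lt_le_trans xy. Qed.

Lemma infinitely_large_divn (R : numFieldType) (x : R) m :
  infinitely_large x -> infinitely_large (x / m.+1%:R).
Proof. by move=> hx n; rewrite ltr_pdivlMr ?ltr0Sn // -natrM. Qed.

Section Commensurable.
Variable R : realFieldType.
Implicit Types x y z : R.

(** Equality of Archimedean classes, 0 forming a class of its own. *)
Definition commensurable x y :=
  exists n : nat, `|x| <= n%:R * `|y| /\ `|y| <= n%:R * `|x|.

Lemma commensurable_refl x : commensurable x x.
Proof. by exists 1%N; rewrite mul1r. Qed.

Lemma commensurable_sym x y : commensurable x y -> commensurable y x.
Proof. by move=> [n []]; exists n. Qed.

Lemma commensurable_trans y x z :
  commensurable x y -> commensurable y z -> commensurable x z.
Proof.
move=> [n [h1 h2]] [m [h3 h4]]; exists (n * m)%N; rewrite natrM; split.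
  by rewrite -mulrA (le_trans h1) // ler_wpM2l ?ler0n.
by rewrite [_ * m%:R]mulrC -mulrA (le_trans h4) // ler_wpM2l ?ler0n.
Qed.

Lemma commensurable_norm x : commensurable `|x| x.
Proof. by exists 1%N; rewrite !normr_id !mul1r. Qed.

Lemma commensurableM x y x' y' :
  commensurable x x' -> commensurable y y' -> commensurable (x * y) (x' * y').
Proof.
move=> [n [h1 h2]] [m [h3 h4]]; exists (n * m)%N; rewrite natrM !normrM.
by split; rewrite mulrACA ler_pM.
Qed.

Lemma commensurableV x y : commensurable x y -> commensurable x^-1 y^-1.
Proof.
have [->|x0] := eqVneq x 0.
  move=> [n [_]]; rewrite normr0 mulr0 normr_le0 => /eqP ->.
  exact: commensurable_refl.
have [->|y0] := eqVneq y 0.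
  by move=> [n [+ _]]; rewrite normr0 mulr0 normr_le0 (negPf x0).
move=> [n [h1 h2]]; exists n; rewrite !normfV.
have nx : 0 < `|x| by rewrite normr_gt0.
have ny : 0 < `|y| by rewrite normr_gt0.
split; rewrite -[leLHS]mul1r ler_pdivrMr // mulrAC ler_pdivlMr // mul1r //.
Qed.

Lemma commensurableX x y k : commensurable x y -> commensurable (x ^+ k) (y ^+ k).
Proof.
move=> xy; elim: k => [|k IH]; first exact: commensurable_refl.
by rewrite !exprS; exact: commensurableM.
Qed.

Lemma commensurableX_inv x y k : (0 < k)%N ->
  commensurable (x ^+ k) (y ^+ k) -> commensurable x y.
Proof.
move=> k0 [n [h1 h2]]; exists n.
have nk : n%:R <= n%:R ^+ k :> R by rewrite -natrX ler_nat; case: n {h1 h2} => // n; rewrite -[leqLHS]expn1 leq_pexp2l.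
have aux (u v : R) : `|u ^+ k| <= n%:R * `|v ^+ k| -> `|u| <= n%:R * `|v|.
  rewrite !normrX => h; rewrite -(@ler_pXn2r _ k) ?nnegrE ?mulr_ge0 ?ler0n ?normr_ge0 //.
  by rewrite (le_trans h) // exprMn ler_wpM2r // exprn_ge0.
by split; exact: aux.
Qed.

Lemma commensurable_neq0 x y : commensurable x y -> y != 0 -> x != 0.
Proof.
by move=> [n [_ h]] y0; apply: contra y0 => /eqP x0; rewrite x0 normr0 mulr0 normr_le0 in h.
Qed.

Lemma commensurableD_ge0 x y x' y' : 0 <= x -> 0 <= y -> 0 <= x' -> 0 <= y' ->
  commensurable x x' -> commensurable y y' -> commensurable (x + y) (x' + y').
Proof.
move=> x0 y0 x'0 y'0 [n [h1 h2]] [m [h3 h4]]; exists (n + m)%N.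
have n0 := ler0n R n; have m0 := ler0n R m.
rewrite !ger0_norm ?addr_ge0 // in h1 h2 h3 h4 *.
by rewrite natrD; split; nra.
Qed.

(** Of two different classes one dominates, so no cancellation can occur in the sum. *)
Lemma commensurable_add x y : ~ commensurable x y ->
  commensurable (x + y) x \/ commensurable (x + y) y.
Proof.
move=> nxy.
have [h1|h1] := leP `|x| (2 * `|y|).
  have [h2|h2] := leP `|y| (2 * `|x|); first by case: nxy; exists 2%N.
  right; exists 2%N; split; first by have := ler_normD x y; lra.
  by have := ler_normB (x + y) x; rewrite addrAC subrr add0r; lra.
left; exists 2%N; split; first by have := ler_normD x y; have := normr_ge0 y; lra.
by have := ler_normB (x + y) y; rewrite addrK; have := normr_ge0 y; lra.
Qed.

Lemma commensurable_prod (T : eqType) (s : seq T) (F G : T -> R) :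
  (forall t, commensurable (F t) (G t)) ->
  commensurable (\prod_(t <- s) F t) (\prod_(t <- s) G t).
Proof.
move=> h; elim: s => [|t s IH]; first by rewrite !big_nil; exact: commensurable_refl.
by rewrite !big_cons; exact: commensurableM.
Qed.

End Commensurable.

Lemma rcf_root (R : rcfType) (e : R) k : 0 <= e -> (0 < k)%N ->
  exists2 y, 0 <= y & y ^+ k = e.
Proof.
move=> e0 k0; have [||y /andP[y0 _]] := @poly_ivt R ('X^k - e%:P) 0 (1 + e).
- by rewrite addr_ge0.
- rewrite !hornerE expr0n gtn_eqF // sub0r oppr_le0 e0 subr_ge0 /=.
  apply: (@le_trans _ _ (1 + e)); first by rewrite lerDr.
  by rewrite -[leLHS]expr1 ler_weXn2l // lerDl.
by rewrite rootE !hornerE subr_eq0 => /eqP; exists y.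
Qed.

(** * Subfields that omit the gap *)

Section Subfields.
Variables (L : fieldType) (S : set L).
Hypothesis subS : subfield_set S.

Lemma subfield0 : S 0.
Proof. by have [S1 SB _] := subS; rewrite -(subrr 1); exact: SB. Qed.

Lemma subfieldN x : S x -> S (- x).
Proof.
by have [_ SB _] := subS => Sx; rewrite -sub0r; apply: SB => //; exact: subfield0.
Qed.

Lemma subfieldD x y : S x -> S y -> S (x + y).
Proof.
by have [_ SB _] := subS => Sx Sy; rewrite -(opprK y); apply: SB => //; exact: subfieldN.
Qed.

Lemma subfield_nat n : S n%:R.
Proof.
have [S1 _ _] := subS; elim: n => [|n IH]; first exact: subfield0.
by rewrite -natr1; exact: subfieldD.
Qed.

End Subfields.

Section MonotoneEmbedding.
Variables (K L : realFieldType) (v : {rmorphism K -> L}).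
Hypothesis v_mono : {mono v : x y / x <= y}.

Lemma lt_mono_rmorph x y : (v x < v y) = (x < y).
Proof. by rewrite !ltNge v_mono. Qed.

Lemma norm_mono_rmorph x : `|v x| = v `|x|.
Proof.
have [x0|x0] := leP 0 x.
  by rewrite !ger0_norm // -[X in X <= _](rmorph0 v) v_mono.
by rewrite !ltr0_norm ?rmorphN // -[X in _ < X](rmorph0 v) lt_mono_rmorph.
Qed.

End MonotoneEmbedding.

Section Gap.
Variables (I : Type) (L : rcfType) (F0 : set L).
Hypothesis fillF : filling I F0.

Definition gap w := infinitely_large w /\
  forall b, F0 b -> infinitely_large b -> w < b.

Let subF : subfield_set F0.
Proof. by case: fillF. Qed.

Lemma gap_gt0 w : gap w -> 0 < w.
Proof. by move=> [/(_ 0%N)]. Qed.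

(** The infinite elements of [F0] are stable under division by positive integers, so standard
    factors do not lead out of the gap. *)
Lemma gap_commensurable u w : gap u -> commensurable u w -> 0 < w -> gap w.
Proof.
move=> [uinf ult] [n [h1 h2]] w0; have u0 : 0 < u := uinf 0%N.
rewrite !gtr0_norm // in h1 h2; split=> [m|b Fb binf].
  have n0 : 0 < n%:R :> L.
    by rewrite lt0r ler0n andbT; apply: contraL h1 => /eqP ->; rewrite mul0r leNgt u0.
  by rewrite -(ltr_pM2l n0) -natrM; apply: lt_le_trans h1; exact: uinf.
apply: (le_lt_trans h2); apply: (@le_lt_trans _ _ (n.+1%:R * u)).
  by rewrite ler_pM2r // ler_nat.
rewrite mulrC -ltr_pdivlMr ?ltr0Sn //; apply: ult; last exact: infinitely_large_divn.
by have [_ _ SV] := subF; apply: SV => //; exact: subfield_nat.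
Qed.

(** [F0] is closed under square roots: [j] of them reduce a bound on [w ^+ (2 ^ j)] to one on [w],
    and [k < 2 ^ k] handles the other exponents. *)
Lemma gapX w k : gap w -> (0 < k)%N -> gap (w ^+ k).
Proof.
move=> [winf wlt] k0; have w1 : 1 <= w by exact/ltW/(winf 1%N).
split.
  by apply: infinitely_large_le winf _; rewrite -[leLHS]expr1 ler_weXn2l.
have pow2 j b : F0 b -> infinitely_large b -> w ^+ (2 ^ j) < b.
  elim: j b => [|j IH] b Fb binf; first by rewrite expr1; exact: wlt.
  have b0 : 0 < b := binf 0%N.
  rewrite expnSr exprM -(sqr_sqrtr (ltW b0)) ltr_pXn2r ?nnegrE ?sqrtr_ge0 ?exprn_ge0 ?(le_trans _ w1) //.
  apply: IH; first by have [_ _ _ Fs _] := fillF; exact: Fs.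
  move=> n; rewrite -(@ltr_pXn2r _ 2) ?nnegrE ?sqrtr_ge0 ?ler0n // sqr_sqrtr ?ltW //.
  by rewrite -natrX.
move=> b Fb binf; apply: le_lt_trans (pow2 k b Fb binf).
by rewrite ler_weXn2l // ltnW // ltn_expl.
Qed.

Lemma gapX_inv u k : 0 < u -> (0 < k)%N -> gap (u ^+ k) -> gap u.
Proof.
move=> u0 k0 [uinf ult]; split.
  move=> n; rewrite ltNge; apply/negP => un.
  have := uinf (n ^ k)%N; rewrite ltNge => /negP; apply.
  by rewrite natrX lerXn2r // nnegrE ?ler0n // ltW.
move=> b Fb binf; rewrite ltNge; apply/negP => bu.
have := ult b Fb binf; rewrite ltNge => /negP; apply.
apply: (le_trans bu); rewrite -[leLHS]expr1 ler_weXn2l //.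
by apply: le_trans bu; exact/ltW/(binf 1%N).
Qed.

Section Extension.
Variables (K : realFieldType) (v : {rmorphism K -> L}).
Hypothesis v_mono : {mono v : x y / x <= y}.
Hypothesis F0K : forall y, F0 y -> exists x, v x = y.
Hypothesis K_omits : forall x, ~ gap (v x).

Let v_norm := norm_mono_rmorph v_mono.

Lemma omits_commensurable w e : gap w -> ~ commensurable w (v e).
Proof.
move=> gw h; apply: (@K_omits `|e|); rewrite -v_norm.
apply: (gap_commensurable gw).
  by apply: commensurable_trans h _; exact/commensurable_sym/commensurable_norm.
rewrite normr_gt0; apply: (commensurable_neq0 (commensurable_sym h)).
by rewrite gt_eqF //; exact: (gap_gt0 gw).
Qed.

(** Under the hypothesis on powers of [x], distinct monomials have distinct classes, so a single one
    dominates the value of the polynomial. *)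
Lemma horner_commensurable (x : L) (p : {poly K}) :
  (forall k e, (0 < k)%N -> ~ commensurable (x ^+ k) (v e)) -> p != 0 ->
  exists e i, e != 0 /\ commensurable (map_poly v p).[x] (v e * x ^+ i).
Proof.
move=> hx; elim/poly_ind: p => [/eqP//|p c IH] pc0.
rewrite rmorphD rmorphM /= map_polyX map_polyC hornerMXaddC -[X in _ + X]/(v c).
have [p0|/IH[e [i [e0 he]]]] := eqVneq p 0.
  exists c, 0%N; split; first by move: pc0; rewrite p0 mul0r add0r polyC_eq0.
  by rewrite p0 rmorph0 horner0 mul0r add0r expr0 mulr1; exact: commensurable_refl.
have he1 : commensurable ((map_poly v p).[x] * x) (v e * x ^+ i.+1).
  by rewrite exprSr mulrA; apply: commensurableM he _; exact: commensurable_refl.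
have [->|c0] := eqVneq c 0.
  by exists e, i.+1; rewrite rmorph0 addr0.
have nc : ~ commensurable ((map_poly v p).[x] * x) (v c).
  move=> hc; apply: (hx i.+1 (c / e)) => //.
  rewrite rmorphM /= fmorphV -[x ^+ _](mulKf (x := v e)) ?fmorph_eq0 // mulrC.
  apply: commensurableM; last exact: commensurable_refl.
  exact: commensurable_trans (commensurable_sym he1) hc.
have [h|h] := commensurable_add nc.
  by exists e, i.+1; split=> //; exact: commensurable_trans h he1.
by exists c, 0%N; split=> //; rewrite expr0 mulr1.
Qed.

Lemma gap_transcendental w : gap w -> ~ algebraicOver v w.
Proof.
move=> gw [p p0 /rootP rp].
have [|e [i [e0 he]]] := @horner_commensurable w p _ p0.
  by move=> k e k0; apply: omits_commensurable; exact: gapX.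
have := commensurable_neq0 he; rewrite rp eqxx mulf_eq0 fmorph_eq0 (negPf e0) /=.
by rewrite expf_eq0 gt_eqF ?(gap_gt0 gw) // andbF => /(_ isT).
Qed.

Hypothesis K_max : forall S : set L, subfield_set S -> (forall x, S (v x)) ->
  (forall w, S w -> ~ gap w) -> forall y, S y -> exists x, v x = y.

(** The algebraic elements form a subfield, and it omits the gap because gap elements are
    transcendental; maximality applies. *)
Lemma algebraic_in_maximal y : algebraicOver v y -> exists x, v x = y.
Proof.
apply: (K_max (S := [set y | algebraicOver v y])) => [|x|w Aw gw].
- split; first exact: algebraic1.
    by move=> x z; exact: algebraic_sub.
  by move=> x z; exact: algebraic_div.
- exact: algebraic_id.
- exact: gap_transcendental gw Aw.
Qed.

Lemma maximal_real_closed : Num.real_closed_axiom K.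
Proof.
move=> p a b ab /andP[pa pb].
have [->|p0] := eqVneq p 0; first by exists a; rewrite ?lexx //= rootE horner0.
have [||y /andP[ay yb] ry] := @poly_ivt L (map_poly v p) (v a) (v b).
- by rewrite v_mono.
- by rewrite !horner_map -(rmorph0 v) !v_mono pa.
have [x xy] := algebraic_in_maximal (ex_intro2 _ _ p p0 ry).
exists x; first by rewrite -!v_mono xy ay.
by rewrite -(fmorph_root v) xy.
Qed.

(** Otherwise the field [K(z)] of these fractions would omit the gap, and maximality would put [z]
    in [K]. *)
Lemma rational_gap z : (forall x, v x <> z) -> exists p q : {poly K},
  (map_poly v q).[z] != 0 /\ gap ((map_poly v p).[z] / (map_poly v q).[z]).
Proof.
move=> zK; apply: contrapT => nh.
pose S := [set x | exists p q : {poly K}, (map_poly v q).[z] != 0 /\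
  x = (map_poly v p).[z] / (map_poly v q).[z]].
have [||||x /zK//] := @K_max S _ _ _ z.
- split.
  + by exists 1, 1; rewrite rmorph1 hornerC oner_eq0 divr1.
  + move=> _ _ [p [q [q0 ->]]] [p' [q' [q'0 ->]]].
    exists (p * q' - p' * q), (q * q'); rewrite !rmorphM rmorphB /= !rmorphM /=.
    rewrite !(hornerM, hornerD, hornerN) mulf_neq0 //; split=> //.
    by field; rewrite q0 q'0.
  + move=> _ _ [p [q [q0 ->]]] [p' [q' [q'0 ->]]].
    have [p'0|p'0] := eqVneq (map_poly v p').[z] 0.
      exists 0, 1; rewrite rmorph1 hornerC oner_eq0 p'0 mul0r invr0 mulr0.
      by rewrite map_poly0 horner0 mul0r.
    exists (p * q'), (q * p'); rewrite !rmorphM /= !hornerM mulf_neq0 //.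
    by split=> //; field; rewrite q0 p'0.
- move=> x; exists x%:P, 1.
  by rewrite rmorph1 hornerC oner_eq0 divr1 map_polyC hornerC.
- by move=> w [p [q [q0 ->]]] gw; apply: nh; exists p, q.
- exists 'X, 1; by rewrite rmorph1 hornerC oner_eq0 divr1 map_polyX hornerX.
Qed.

End Extension.
End Gap.

(** * Cuts of the maximal subfield *)

Section Cuts.
Variables (I : Type) (L : rcfType) (F0 : set L).
Hypothesis fillF : filling I F0.
Variables (K : rcfType) (v : {rmorphism K -> L}).
Hypothesis v_mono : {mono v : x y / x <= y}.
Hypothesis F0K : forall y, F0 y -> exists x, v x = y.
Hypothesis K_omits : forall x, ~ gap F0 (v x).
Hypothesis K_max : forall S : set L, subfield_set S -> (forall x, S (v x)) ->
  (forall w, S w -> ~ gap F0 w) -> forall y, S y -> exists x, v x = y.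

Let v_lt := lt_mono_rmorph v_mono.

Let v_norm := norm_mono_rmorph v_mono.

Let omits := omits_commensurable fillF v_mono K_omits.

Let commensurable_root x e k : (0 < k)%N -> commensurable (x ^+ k) (v e) ->
  exists y, commensurable x (v y).
Proof.
move=> k0 h; have [y y0 ye] := @rcf_root K `|e| k (normr_ge0 e) k0.
exists y; apply: (commensurableX_inv k0); rewrite -rmorphXn /= ye -v_norm.
by apply: commensurable_trans h _; exact/commensurable_sym/commensurable_norm.
Qed.

(* If [z] is as close to each [c] as an element of [K], then so is [p.[z]] for
   every polynomial [p] over [K], by splitting [p] over [K(i)]; then [K(z)]
   omits the gap. *)
Lemma exists_new_distance z : (forall x, v x <> z) ->
  exists c, forall e, ~ commensurable (z - v c) (v e).
Proof.
move=> zK; apply: contrapT => nh.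
have h c : exists e, commensurable (z - v c) (v e).
  apply: contrapT => nc; apply: nh; exists c => e he.
  by apply: nc; exists e.
have hp (p : {poly K}) : exists e, commensurable (map_poly v p).[z] (v e).
  have [c [rs e]] := sqr_poly_rcf p.
  have /choice[d hd] : forall r : K * K, exists e, 0 <= e /\
      commensurable ((z - v r.1) ^+ 2 + v r.2 ^+ 2) (v e).
    move=> r; have [e' he'] := h r.1; exists (e' ^+ 2 + r.2 ^+ 2).
    split; first by rewrite addr_ge0 ?sqr_ge0.
    rewrite rmorphD !rmorphXn /=.
    apply: commensurableD_ge0; rewrite ?sqr_ge0 //; last exact: commensurable_refl.
    exact: commensurableX.
  (* It is enough to find the class of the square: its factors are sums of squares, so nothing
     cancels, and [K] has square roots. *)
  apply: (@commensurable_root _ (c * \prod_(r <- rs) d r) 2) => //.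
  rewrite -horner_exp -rmorphXn /= e [map_poly v _]rmorphM /= map_polyC.
  rewrite hornerM hornerC [v (c * _)]rmorphM /=.
  apply: commensurableM; first exact: commensurable_refl.
  rewrite !rmorph_prod /= horner_prod; apply: commensurable_prod => r.
  rewrite rmorphD /= rmorphXn /= map_polyXsubC map_polyC.
  rewrite hornerD horner_exp hornerXsubC hornerC /= rmorphXn /=.
  by have [] := hd r.
have [p [q [q0 gpq]]] := rational_gap K_max zK.
have [[e1 he1] [e2 he2]] := (hp p, hp q).
apply: (@omits _ (e1 / e2) gpq); rewrite rmorphM /= fmorphV.
by apply: commensurableM => //; exact: commensurableV.
Qed.

(** With [x = z - v c] as far from [K] as possible, a gap element of [K(x)] has the class of
    [e * x ^ (i - j)] for some [e] in [K]. Equal exponents are excluded because [K] omits the gap;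
    otherwise a root of order [|i - j|] puts [y * |x|] or [y / |x|] in the gap, where [y] is a root
    of [|e|]. *)
Lemma outside_shape z : (forall x, v x <> z) ->
  exists c g u, [/\ g != 0, gap F0 u & z = v c + v g * u \/ z = v c + v g / u].
Proof.
move=> zK; have [c hc] := exists_new_distance zK.
pose x := z - v c.
have xK y : v y <> x.
  by move=> yx; apply: (zK (y + c)); rewrite rmorphD /= yx subrK.
have x0 : x != 0 by apply/eqP => x0; apply: (xK 0); rewrite rmorph0 x0.
have nx0 : 0 < `|x| by rewrite normr_gt0.
have hx k e : (0 < k)%N -> ~ commensurable (x ^+ k) (v e).
  by move=> k0 /(commensurable_root k0)[y]; exact: hc.
have [p [q [q0 gpq]]] := rational_gap K_max xK.
have p0 : p != 0.
  apply: contraTneq (gap_gt0 gpq) => ->.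
  by rewrite map_poly0 horner0 mul0r ltxx.
have q0' : q != 0.
  by apply: contraNneq q0 => ->; rewrite map_poly0 horner0.
have [e1 [i [e10 h1]]] := horner_commensurable hx p0.
have [e2 [j [e20 h2]]] := horner_commensurable hx q0'.
have := commensurableM h1 (commensurableV h2).
set w := _ / _ in gpq *; rewrite invfM mulrACA -fmorphV -rmorphM /=.
set e := e1 / e2; have e0 : e != 0 by rewrite mulf_neq0 ?invr_eq0.
have ne0 : 0 < `|e| by rewrite normr_gt0.
have root_pos k : (0 < k)%N -> exists2 y, 0 < y & y ^+ k = `|e|.
  move=> k0; have [y y0 ye] := rcf_root (ltW ne0) k0; exists y => //.
  rewrite lt0r y0 andbT; apply: contraL ne0 => /eqP y0'.
  by rewrite -ye y0' expr0n gtn_eqF // ltxx.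
have vpos y : 0 < y -> 0 < v y by rewrite -(rmorph0 v) v_lt.
have key (t : L) k y : (0 < k)%N -> 0 < y -> y ^+ k = `|e| -> 0 < t ->
    commensurable w (v e * t ^+ k) -> gap F0 (v y * t).
  move=> k0 y0 ye t0 h.
  apply: (gapX_inv _ k0); first by rewrite mulr_gt0 ?vpos.
  apply: (gap_commensurable fillF gpq); last by rewrite exprn_gt0 // mulr_gt0 ?vpos.
  apply: commensurable_trans h _; rewrite exprMn -rmorphXn /= ye -v_norm.
  apply: commensurableM; last exact: commensurable_refl.
  exact/commensurable_sym/commensurable_norm.
have normX k : commensurable (x ^+ k) (`|x| ^+ k).
  by apply: commensurableX; exact/commensurable_sym/commensurable_norm.
have sgx : z = v c + v (Num.sg 1) * x by rewrite sgr1 rmorph1 mul1r /x addrC subrK.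
have [ij|ji|ij] := ltngtP i j.
- rewrite -(subnK (ltnW ij)) exprD invfM [x ^+ i * _]mulrCA mulfV ?expf_neq0 // mulr1 => h.
  have k0 : (0 < j - i)%N by rewrite subn_gt0.
  have [y y0 ye] := root_pos _ k0.
  exists c, (if 0 < x then y else - y), (v y * `|x|^-1); split.
  + by case: ifP => _; rewrite ?oppr_eq0 gt_eqF.
  + apply: (key _ _ _ k0 y0 ye); first by rewrite invr_gt0.
    apply: commensurable_trans h _; apply: commensurableM.
      exact: commensurable_refl.
    by rewrite exprVn; apply: commensurableV.
  + right; have vy0 : v y != 0 by rewrite gt_eqF // vpos.
    case: ifP => xs; last rewrite rmorphN /=.
      rewrite gtr0_norm // /x; field.
      by rewrite vy0 -/x x0.
    rewrite ltr0_norm; last by rewrite lt_neqAle x0 leNgt xs.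
    rewrite /x; field.
    by rewrite vy0 -/x x0.
- rewrite -(subnK (ltnW ji)) exprD mulrK ?unitfE ?expf_neq0 // => h.
  have k0 : (0 < i - j)%N by rewrite subn_gt0.
  have [y y0 ye] := root_pos _ k0.
  exists c, (if 0 < x then y^-1 else - y^-1), (v y * `|x|); split.
  + by case: ifP => _; rewrite ?oppr_eq0 invr_eq0 gt_eqF.
  + apply: (key _ _ _ k0 y0 ye) => //.
    apply: commensurable_trans h _; apply: commensurableM => //.
    exact: commensurable_refl.
  + left; have vy0 : v y != 0 by rewrite gt_eqF // vpos.
    case: ifP => xs; rewrite ?rmorphN /= fmorphV.
      by rewrite gtr0_norm // mulKf // /x addrC subrK.
    rewrite ltr0_norm; last by rewrite lt_neqAle x0 leNgt xs.
    by rewrite mulrN mulrNN mulKf // /x addrC subrK.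
- rewrite ij mulfV ?expf_neq0 // mulr1 => /(omits gpq) [].
Qed.

(** Both expressions increase with [u], so they carry the cut of [u] to that of [z] without
    reversing its sides. The opposite orientation is covered by [- z]. *)
Definition right_type z := exists c g u, [/\ 0 < g, gap F0 u
  & z = v c + v g * u \/ z = v c - v g / u].

Lemma outside_type z : (forall x, v x <> z) -> right_type z \/ right_type (- z).
Proof.
move=> /outside_shape[c [g [u [g0 gu h]]]].
have [gp|gn|/eqP] := ltgtP g 0; last by rewrite (negPf g0).
  have ng : 0 < - g by rewrite oppr_gt0.
  case: h => ->; [right|left].
    by exists (- c), (- g), u; split => //; left; rewrite !rmorphN /= opprD mulNr.
  by exists c, (- g), u; split => //; right; rewrite rmorphN /= mulNr opprK.
case: h => ->; [left|right].
  by exists c, g, u; split => //; left.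
by exists (- c), g, u; split => //; right; rewrite rmorphN /= opprD.
Qed.

(** Each [h n] above [u] bounds some infinite element of [F0], or else it would lie in the gap.
    These countably many elements have a common infinite lower bound in [F0], which is halved to
    make the inequality strict. *)
Lemma gap_above u (h : nat -> K) : gap F0 u -> exists b,
  [/\ 0 < b, u < v b & forall n, u < v (h n) -> b < h n].
Proof.
move=> [uinf ult].
have [subF _ Fdir _ [[a0 Fa0 a0inf] _]] := fillF.
have [_ _ FV] := subF.
have /choice[b hb] : forall n, exists b, [/\ F0 b, infinitely_large b & u < v (h n) -> b <= v (h n)].
  move=> n; have [uh|uh] := pselect (u < v (h n)); last by exists a0.
  apply: contrapT => nh; apply: (@K_omits (h n)); split.
    by apply: infinitely_large_le uinf _; exact: ltW.
  move=> b Fb binf; rewrite ltNge; apply/negP => hb.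
  by apply: nh; exists b.
have [n|c [Fc cinf cb]] := Fdir b; first by have [] := hb n.
have [d dc] := F0K Fc.
have dinf : infinitely_large (v (d / 2)).
  rewrite rmorphM /= dc fmorphV rmorph_nat.
  exact: (infinitely_large_divn 1 cinf).
have Fd : F0 (v (d / 2)).
  rewrite rmorphM /= dc fmorphV rmorph_nat; apply: FV => //.
  exact: (subfield_nat subF).
exists (d / 2); split; first by rewrite -v_lt rmorph0; exact: (dinf 0%N).
  exact: ult.
move=> n uh; have [_ _ /(_ uh) bh] := hb n.
have : d <= h n by rewrite -v_mono dc (le_trans (cb n)).
have : 0 < d by rewrite -v_lt rmorph0 dc; exact: (cinf 0%N).
by lra.
Qed.

Lemma gap_below u x : gap F0 u -> v x < u -> exists n : nat, x <= n%:R.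
Proof.
move=> [uinf ult] xu; apply: contrapT => nh; apply: (@K_omits x); split.
  move=> n; rewrite -(rmorph_nat v) v_lt ltNge; apply/negP => xn.
  by apply: nh; exists n.
by move=> b Fb binf; apply: lt_trans xu _; exact: ult.
Qed.

(** [gap_above] is transported through the increasing map that sends [u] to [z]. *)
Lemma right_type_above z (y : nat -> K) : right_type z ->
  (forall n, z < v (y n)) -> exists k, z < v k /\ forall n, k < y n.
Proof.
move=> [c [g [u [g0 gu h]]]] zy.
have vg0 : 0 < v g by rewrite -(rmorph0 v) v_lt.
have u0 := gap_gt0 gu.
case: h => ez.
  have [b [b0 ub hb]] := gap_above (fun n => (y n - c) / g) gu.
  exists (c + g * b); split.
    by rewrite ez rmorphD rmorphM /= ltrD2l ltr_pM2l.
  move=> n; rewrite -ltrBrDl mulrC -ltr_pdivlMr //; apply: hb.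
  by rewrite rmorphM fmorphV rmorphB /= ltr_pdivlMr // mulrC ltrBrDl -ez.
have [b [b0 ub hb]] := gap_above (fun n => g / (c - y n)) gu.
have vb0 : 0 < v b := lt_trans u0 ub.
exists (c - g / b); split.
  by rewrite ez rmorphB rmorphM /= fmorphV ltrD2l ltrN2 ltr_pM2l // ltf_pV2.
move=> n; have [cy|yc] := leP c (y n).
  by apply: lt_le_trans cy; rewrite ltrBlDr ltrDl divr_gt0.
have cy0 : 0 < c - y n by rewrite subr_gt0.
have vcy0 : 0 < v c - v (y n) by rewrite subr_gt0 v_lt.
have : b < g / (c - y n).
  apply: hb; rewrite rmorphM fmorphV rmorphB /= ltr_pdivlMr // mulrC -ltr_pdivlMr //.
  by have := zy n; rewrite ez ltrBlDr -ltrBlDl.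
rewrite ltr_pdivlMr // mulrC -ltr_pdivlMr //; lra.
Qed.

(** Otherwise the powers of [a] would be cofinal below [z]. By [gap_below] they would be mutually
    cofinal with [c + g * n] or [c - g / n.+1], which advance too slowly for multiplication by an
    infinite [a]. *)
Lemma right_type_powers z a : right_type z -> infinitely_large a ->
  (forall n, v (a ^+ n) < z) -> exists k, (forall n, a ^+ n < k) /\ v k < z.
Proof.
move=> [c [g [u [g0 gu h]]]] ainf az.
have vg0 : 0 < v g by rewrite -(rmorph0 v) v_lt.
have u0 := gap_gt0 gu; have uinf := proj1 gu.
have a0 : 0 < a := ainf 0%N.
apply: contrapT => nh.
have cof k : v k < z -> exists n, k <= a ^+ n.
  move=> kz; apply: contrapT => nk; apply: nh; exists k; split=> // n.
  by rewrite ltNge; apply/negP => kn; apply: nk; exists n.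
case: h => ez.
  have bnd m : exists n : nat, a ^+ m <= c + g * n%:R.
    have [|n hn] := @gap_below u ((a ^+ m - c) / g) gu.
      by rewrite rmorphM fmorphV rmorphB /= ltr_pdivrMr // mulrC ltrBlDl -ez.
    by exists n; rewrite -lerBlDl mulrC -ler_pdivrMr.
  (* [n0] makes [c + g * n0] at least 1, so a power beyond the next term dominates both [c] and [g].
     The following power is then at most [n' + 1] times as large, whereas [a] is infinite. *)
  have [n0 hn0] := bnd 0%N.
  have [|m1 hm1] := cof (c + g * n0%:R + g).
    rewrite -addrA -{2}[g]mulr1 -mulrDr ez rmorphD rmorphM /= ltrD2l ltr_pM2l //.
    by rewrite natr1 rmorph_nat.
  have [n' hn'] := bnd m1.+1.
  have := ainf n'.+1; rewrite ltNge => /negP; apply.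
  have am0 : 0 < a ^+ m1 by rewrite exprn_gt0.
  rewrite -(ler_pM2r am0) -exprS (le_trans hn') // -natr1 mulrDl mul1r.
  have n'0 := ler0n K n'; have n00 := ler0n K n0.
  rewrite expr0 in hn0.
  have h1 : g <= a ^+ m1 by lra.
  have h2 : c <= a ^+ m1 by have := mulr_ge0 (ltW g0) n00; lra.
  have h3 : g * n'%:R <= n'%:R * a ^+ m1 by rewrite mulrC ler_wpM2l.
  lra.
have zc : z < v c by rewrite ez ltrBlDr ltrDl divr_gt0.
have ac m : 0 < c - a ^+ m by rewrite subr_gt0 -v_lt (lt_trans (az m)).
have bnd m : exists n : nat, a ^+ m <= c - g / n.+1%:R.
  have [|n hn] := @gap_below u (g / (c - a ^+ m)) gu.
    have vac : 0 < v (c - a ^+ m) by rewrite -(rmorph0 v) v_lt.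
    rewrite rmorphM fmorphV /= ltr_pdivrMr // mulrC -ltr_pdivrMr //.
    by rewrite rmorphB /= ltrBrDl -ltrBrDr -ez az.
  exists n; rewrite lerBrDl -lerBrDr ler_pdivrMr ?ltr0Sn //.
  rewrite ler_pdivrMr // in hn; apply: (le_trans hn).
  rewrite [leRHS]mulrC; apply: ler_wpM2r; first exact: ltW.
  by rewrite ler_nat.
have [n0 hn0] := bnd 0%N.
(* Here [1 <= c - d], so doubling a power that is at least [c - d / 2] already passes [c], hence
   [z]. *)
pose d := g / n0.+1%:R; have d0 : 0 < d by rewrite divr_gt0 ?ltr0Sn.
have [|m1 hm1] := cof (c - d / 2).
  rewrite ez !rmorphB /= ltrD2l ltrN2 /d rmorphM rmorphM /= !fmorphV !rmorph_nat.
  rewrite -mulrA ltr_pM2l // -invfM -natrM ltf_pV2 ?posrE ?ltr0n ?muln_gt0 //.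
have := az m1.+1; rewrite ltNge => /negP; apply; apply/ltW/(lt_le_trans zc).
rewrite v_mono exprS.
have am0 : 0 < a ^+ m1 by rewrite exprn_gt0.
rewrite expr0 -/d in hn0.
have : 2 * a ^+ m1 <= a * a ^+ m1 by rewrite ler_pM2r // ltW // (ainf 2).
lra.
Qed.

End Cuts.

(** * The field K *)

Lemma exists_maximal_omitting (I : Type) (L : rcfType) (F0 : set L) :
  filling I F0 -> exists (K : rcfType) (v : {rmorphism K -> L}),
  [/\ {mono v : x y / x <= y}, forall y, F0 y -> exists x, v x = y,
      forall x, ~ gap F0 (v x)
    & forall S : set L, subfield_set S -> (forall x, S (v x)) ->
        (forall w, S w -> ~ gap F0 w) -> forall y, S y -> exists x, v x = y].
Proof.
move=> fillF; have [subF _ _ _ _] := fillF.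
pose good S := [/\ subfield_set S, F0 `<=` S & forall w, S w -> ~ gap F0 w].
have goodF : good F0.
  split=> // w Fw [winf wlt]; have := wlt w Fw winf; by rewrite ltxx.
have [C CP Ctot|S [hS Smax]] := @Zorn_bigcup L [set S | S = set0 \/ good S].
  have [[S0 CS0 gS0]|nS] := pselect (exists2 S, C S & good S); last first.
    left; rewrite bigcup0 // => S CS.
    by have [//|gS] := CP _ CS; case: nS; exists S.
  have gC S x : C S -> S x -> good S by move=> /CP[->|].
  have two x y : (\bigcup_(S in C) S) x -> (\bigcup_(S in C) S) y ->
      exists S, [/\ C S, good S, S x & S y].
    move=> [S1 CS1 S1x] [S2 CS2 S2y]; have [h|h] := Ctot _ _ CS1 CS2.
      by exists S2; split=> //; [exact: gC S2y|exact: h].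
    by exists S1; split=> //; [exact: gC S1x|exact: h].
  right; split.
  - split.
    + by exists S0 => //; have [[]] := gS0.
    + move=> x y Ux Uy; have [S [CS [[_ SB _] _ _] Sx Sy]] := two x y Ux Uy.
      by exists S => //; exact: SB.
    + move=> x y Ux Uy; have [S [CS [[_ _ SV] _ _] Sx Sy]] := two x y Ux Uy.
      by exists S => //; exact: SV.
  - by move=> x Fx; exists S0 => //; have [_ + _] := gS0; apply.
  - by move=> w [S CS Sw]; have [_ _ ] := gC _ _ CS Sw; apply.
have gS : good S.
  case: hS => // S0; exfalso; apply: (Smax F0); last by right.
  rewrite S0; split=> // /(_ 1); apply.
  by have [] := subF.
have [subS FS Somit] := gS.
have [K0 [v [vS Sv v_mono]]] := subfield_type subS.
have F0K y : F0 y -> exists x, v x = y by move=> /FS; exact: Sv.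
have K_omits x : ~ gap F0 (v x) by exact: Somit.
have K_max (S' : set L) : subfield_set S' -> (forall x, S' (v x)) ->
    (forall w, S' w -> ~ gap F0 w) -> forall y, S' y -> exists x, v x = y.
  move=> subS' vS' S'omit y S'y; apply: contrapT => ny.
  apply: (Smax S'); last first.
    by right; split=> // z Fz; have [x <-] := F0K z Fz.
  split; first by move=> z /Sv[x <-].
  by move=> /(_ y S'y)/Sv.
pose K : rcfType := HB.pack_for rcfType K0
  (Num.RealField_isClosed.Build K0 (maximal_real_closed fillF v_mono K_omits K_max)).
by exists K, (v : {rmorphism K -> L}).
Qed.

Lemma exists_asymmetric_rcf (k : rcfType) : exists (I : Type) (K : rcfType),
  [/\ forall x y : nat -> K, (forall m n, x m < y n) ->
        exists z, forall n, x n < z < y n,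
      exists a : K, infinitely_large a,
      exists b : I -> K, forall x, infinitely_large x ->
        exists i, infinitely_large (b i) /\ b i <= x
    & forall (a : K) (s : I -> K), infinitely_large a -> exists z,
        (forall n, a ^+ n < z) /\
        forall i, (forall n, a ^+ n < s i) -> z < s i].
Proof.
have [L [F0 fillF]] := exists_filling_rcf k.
set I := nat -> k in fillF; exists I.
have [K [v [v_mono F0K K_omits K_max]]] := exists_maximal_omitting fillF.
have v_lt := lt_mono_rmorph v_mono.
have v_inf x : infinitely_large (v x) <-> infinitely_large x.
  by split=> h n; have := h n; rewrite -(rmorph_nat v) v_lt.
have [subF [enum enumP] _ _ [[a0 Fa0 a0inf] fillL]] := fillF.
have above := right_type_above fillF v_mono F0K K_omits.
have otype z := outside_type fillF v_mono K_omits K_max (z := z).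
have fill_nat (x y : nat -> L) : {homo x : m n / (m <= n)%N >-> m <= n} ->
    (forall m n, x m < y n) -> exists z, forall n, x n <= z /\ z < y n.
  move=> xmono xy.
  (* [y] becomes an [I]-indexed family through the indices of the natural numbers, which lie in
     [F0]. *)
  have [z hz] := fillL x (fun i => y (xget 0%N [set n | enum i = n%:R])) xmono
    (fun n i => xy n _).
  exists z => n; have [i ei] := enumP _ (subfield_nat subF n).
  have [h1 h2] := hz n i; split=> //; move: h2.
  case: xgetP => [m _ /=|/(_ n)[] //]; rewrite ei => /eqP.
  by rewrite eqr_nat => /eqP ->.
have eta_aux (x y : nat -> L) : (forall m n, x m < y n) ->
    exists z, forall n, x n <= z /\ z < y n.
  (* Running maxima provide the monotone sequence that [fill_nat] asks for. *)
  move=> xy; pose X n := \big[Order.max/x 0%N]_(i < n.+1) x i.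
  have Xge m n : (m <= n)%N -> x m <= X n.
    by move=> mn; exact: (le_bigmax _ (fun i : 'I_n.+1 => x i) (Ordinal (mn : (m < n.+1)%N))).
  have Xlt n m : X n < y m by apply/bigmax_ltP; split.
  have [||z hz] := @fill_nat X y.
  - move=> m n mn; apply/bigmax_leP; split; first exact: Xge.
    by move=> i _; apply: Xge; rewrite -ltnS (leq_trans (ltn_ord i)).
  - by [].
  by exists z => n; have [h1 h2] := hz n; split=> //; apply: le_trans h1; exact: Xge.
have eta_L (x y : nat -> L) : (forall m n, x m < y n) ->
    exists z, forall n, x n < z < y n.
  (* A second, mirrored application gives [z1 < - z2] with both between the sequences; their
     midpoint is strict on both sides. *)
  move=> xy; have [z1 hz1] := eta_aux x y xy.
  have [|z2 hz2] := eta_aux (fun n => - y n) (fun=> - z1).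
    by move=> m _; rewrite ltrN2; have [] := hz1 m.
  exists ((z1 - z2) / 2) => n; have [h1 h2] := hz1 n; have [h3 h4] := hz2 n.
  have z12 : z1 < - z2 by rewrite ltrNr.
  rewrite (le_lt_trans h1) ?(midf_lt z12) //=.
  by rewrite (lt_le_trans (midf_lt z12).2) // lerNl.
exists K; split.
- move=> x y xy.
  have [|z hz] := eta_L (fun n => v (x n)) (fun n => v (y n)).
    by move=> m n; rewrite v_lt.
  (* If [z] is not in [K], then up to a mirror image no sequence of [K] is coinitial above it, so an
     element of [K] can be found on that side of [z]. *)
  have [[w wz]|zK] := pselect (exists w, v w = z).
    by exists w => n; have := hz n; rewrite -wz !v_lt.
  have [|h|h] := otype z; first by move=> w wz; apply: zK; exists w.
    have [|w [zw wy]] := above _ y h; first by move=> n; have /andP[] := hz n.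
    exists w => n; rewrite wy andbT -v_lt (lt_trans _ zw) //.
    by have /andP[] := hz n.
  have [|w [zw wy]] := above _ (fun n => - x n) h.
    by move=> n; rewrite rmorphN /= ltrN2; have /andP[] := hz n.
  exists (- w) => n; rewrite ltrNr wy /= -v_lt rmorphN /= ltrNl.
  by rewrite (lt_trans _ zw) // ltrN2; have /andP[] := hz n.
- by have [a av] := F0K _ Fa0; exists a; apply/v_inf; rewrite av.
- exists (fun i => xget 0 [set x | v x = enum i]) => x xinf.
  have [b [Fb binf bx]] : exists b, [/\ F0 b, infinitely_large b & b <= v x].
    apply: contrapT => nb; apply: (@K_omits x); split; first exact/v_inf.
    by move=> b Fb binf; rewrite ltNge; apply/negP => bx; apply: nb; exists b.
  have [i ib] := enumP b Fb; have [w wb] := F0K b Fb.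
  exists i; case: xgetP => [y _ /= vy|/(_ w)/=[]]; last by rewrite wb.
  by split; [apply/v_inf|rewrite -v_mono]; rewrite vy ib.
- move=> a s ainf; have a1 : 1 < a := ainf 1%N; have apos : 0 < a := ainf 0%N.
  have va1 : 1 < v a by rewrite -(rmorph1 v) v_lt.
  have pmono : {homo (fun n => v (a ^+ n)) : m n / (m <= n)%N >-> m <= n}.
    by move=> m n mn; rewrite v_mono ler_weXn2l // ltW.
  have pS n : v (a ^+ n) < v (a ^+ n.+1) by rewrite v_lt ltr_eXn2l.
  have [d hd] : exists d : L, forall n, v (a ^+ n) < d.
    (* An upper bound for the powers comes from inverting the distance to 1 of an element between
       all [1 - 1 / a ^ n] and 1. *)
    have [|d hd] := eta_L (fun n => 1 - v (a ^+ n)^-1) (fun=> 1).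
      move=> n _; rewrite ltrBlDr ltrDl -(rmorph0 v) v_lt invr_gt0.
      by rewrite exprn_gt0.
    exists (1 - d)^-1 => n; have /andP[h1 h2] := hd n.
    have p0 : 0 < v (a ^+ n) by rewrite -(rmorph0 v) v_lt exprn_gt0.
    rewrite -[ltLHS]invrK ltf_pV2 ?posrE ?invr_gt0 ?subr_gt0 //.
    by rewrite -fmorphV ltrBlDl -ltrBlDr.
  (* The [s i] that fail to exceed all powers are replaced by the harmless bound [d]. *)
  have [|z hz] := fillL (fun n => v (a ^+ n))
    (fun i => if `[< forall n, a ^+ n < s i >] then v (s i) else d) pmono.
    by move=> n i; case: asboolP => // h; rewrite v_lt.
  have az n : v (a ^+ n) < z.
    have [i _] := enumP _ (subfield_nat subF 0).
    by apply: lt_le_trans (pS n) _; have [] := hz n.+1 i.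
  have zs i : (forall n, a ^+ n < s i) -> z < v (s i).
    by move=> h; have [_] := hz 0%N i; case: asboolP.
  have [[w wz]|zK] := pselect (exists w, v w = z).
    by exists w; split=> [n|i /zs]; rewrite -v_lt wz.
  have [|h|h] := otype z; first by move=> w wz; apply: zK; exists w.
    have [w [aw wz]] := right_type_powers v_mono K_omits h ainf az.
    by exists w; split=> // i /zs zi; rewrite -v_lt (lt_trans wz).
  have [|w [zw wy]] := above _ (fun n => - a ^+ n) h.
    by move=> n; rewrite rmorphN /= ltrN2.
  exists (- w); split=> [n|i /zs zi]; first by rewrite ltrNr.
  by rewrite -v_lt (lt_trans _ zi) // rmorphN /= ltrNl.
Qed.

(** * Saturation *)

Section Tame.
Variable K : rcfType.

(** That is, a finite union of points and intervals; [rs] contains the break points. Quantifier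
    elimination gives definable sets this form. *)
Definition tame (S : set K) := exists rs : seq K, forall x y, x < y ->
  (forall r, r \in rs -> ~~ (x <= r <= y)) -> S x <-> S y.

Lemma tame_cst (P : Prop) : tame (fun=> P).
Proof. by exists [::]. Qed.

Lemma tame_comp2 (c : Prop -> Prop -> Prop) (S T : set K) :
  (forall P P' Q Q' : Prop, (P <-> P') -> (Q <-> Q') -> (c P Q <-> c P' Q')) ->
  tame S -> tame T -> tame (fun x => c (S x) (T x)).
Proof.
move=> cE [rs hS] [ts hT]; exists (rs ++ ts) => x y xy hr.
apply: cE; [apply: hS|apply: hT] => // r rs_r; apply: hr;
  by rewrite mem_cat rs_r ?orbT.
Qed.

Lemma tame_not (S : set K) : tame S -> tame (~` S).
Proof.
by move=> [rs hS]; exists rs => x y xy hr; have := hS x y xy hr; rewrite /setC /=; tauto.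
Qed.

Lemma tame_sgr (p : {poly K}) : exists rs : seq K, forall x y, x < y ->
  (forall r, r \in rs -> ~~ (x <= r <= y)) -> Num.sg p.[x] = Num.sg p.[y].
Proof.
have [->|p0] := eqVneq p 0; first by exists [::] => x y _ _; rewrite !horner0.
exists (rootsR p) => x y xy hr.
have noroot z : x <= z <= y -> ~~ root p z.
  move=> xzy; apply/negP => rz; have zr : z \in rootsR p by rewrite -(roots_on_rootsR p0) rz.
  by have := hr z zr; rewrite xzy.
have px : p.[x] != 0 by apply: (noroot x); rewrite lexx ltW.
have py : p.[y] != 0 by apply: (noroot y); rewrite lexx ltW.
have [x0|x0] := ltP p.[x] 0; have [y0|y0] := ltP p.[y] 0.
- by rewrite !ltr0_sg.
- have [|z xzy rz] := poly_ivt (p := p) (ltW xy); first by rewrite (ltW x0).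
  by have := noroot z xzy; rewrite rz.
- have [|z xzy rz] := poly_ivt (p := - p) (ltW xy).
    by rewrite !hornerN oppr_le0 oppr_ge0 x0 ltW.
  by have := noroot z xzy; rewrite -rootN rz.
- by rewrite !gtr0_sg // lt0r ?px ?py.
Qed.

Lemma eval_rterm_poly (t : GRing.term K) : GRing.rterm t ->
  exists p : {poly K}, forall x, GRing.eval [:: x] t = p.[x].
Proof.
elim: t => //=.
- move=> [|n] _; first by exists 'X => x; rewrite hornerX.
  by exists 0 => x; rewrite horner0 /= nth_default.
- by move=> c _; exists c%:P => x; rewrite hornerC.
- by move=> n _; exists n%:R%:P => x; rewrite hornerC.
- move=> t IHt u IHu /andP[/IHt[p hp] /IHu[q hq]].
  by exists (p + q) => x; rewrite hornerD hp hq.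
- by move=> t IHt /IHt[p hp]; exists (- p) => x; rewrite hornerN hp.
- by move=> t IHt n /IHt[p hp]; exists (p *+ n) => x; rewrite hornerMn hp.
- move=> t IHt u IHu /andP[/IHt[p hp] /IHu[q hq]].
  by exists (p * q) => x; rewrite hornerM hp hq.
- by move=> t IHt n /IHt[p hp]; exists (p ^+ n) => x; rewrite horner_exp hp.
Qed.

Lemma tame_compare (t u : GRing.term K) (S : pred K) :
  GRing.rterm t && GRing.rterm u ->
  tame (fun x => S (Num.sg (GRing.eval [:: x] t - GRing.eval [:: x] u))).
Proof.
move=> /andP[/eval_rterm_poly[p hp] /eval_rterm_poly[q hq]].
have [rs hrs] := tame_sgr (p - q); exists rs => x y xy hr.
by rewrite !hp !hq -!hornerN -!hornerD (hrs x y).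
Qed.

Lemma tame_eq (S T : set K) : tame S -> (forall x, S x <-> T x) -> tame T.
Proof.
by move=> [rs hS] ST; exists rs => x y xy hr; rewrite -!ST; exact: hS.
Qed.

Lemma tame_qf (f : ord.formula K) : ord.qf_form f -> ord.rformula f ->
  tame (fun x => ord.holds [:: x] f).
Proof.
elim: f => //=.
- by move=> b _ _; exact: tame_cst.
- move=> t u _ /(tame_compare (pred1 0)) h; apply: tame_eq h _ => x /=.
  by rewrite sgr_eq0 subr_eq0; split=> /eqP.
- move=> t u _ /(tame_compare (pred1 (-1))) h; apply: tame_eq h _ => x /=.
  by rewrite sgr_cp0 subr_lt0.
- move=> t u _ /(tame_compare (predC1 1)) h; apply: tame_eq h _ => x /=.
  by rewrite sgr_cp0 subr_gt0 -leNgt.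
- move=> f IHf g IHg /andP[qf qg] /andP[rf rg].
  by apply: (@tame_comp2 and (fun x => ord.holds [:: x] f)
    (fun x => ord.holds [:: x] g)); [tauto|exact: IHf|exact: IHg].
- move=> f IHf g IHg /andP[qf qg] /andP[rf rg].
  by apply: (@tame_comp2 or (fun x => ord.holds [:: x] f)
    (fun x => ord.holds [:: x] g)); [tauto|exact: IHf|exact: IHg].
- move=> f IHf g IHg /andP[qf qg] /andP[rf rg].
  by apply: (@tame_comp2 (fun P Q => P -> Q) (fun x => ord.holds [:: x] f)
    (fun x => ord.holds [:: x] g)); [tauto|exact: IHf|exact: IHg].
- by move=> f IHf qf rf; apply: tame_not; exact: IHf.
Qed.

Lemma tame_formula (f : ord.formula K) : ord.rformula f ->
  tame (fun x => ord.holds [:: x] f).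
Proof.
move=> rf.
pose pr i bc := qe_rcf.qfr_to_formula (@qe_rcf.wproj K i bc).
have qfr := @ord.quantifier_elim_wf K pr (@qe_rcf.wf_QE_wproj K) f rf.
have /andP[qg rg] := qfr.
have elimP e := @ord.quantifier_elim_rformP K pr (@qe_rcf.wf_QE_wproj K)
  (@qe_rcf.valid_QE_wproj K) e f rf.
apply: tame_eq (tame_qf qg rg) _ => x.
by split=> [/(ord.qf_evalP _ qg)/elimP|/elimP/(ord.qf_evalP _ qg)].
Qed.

Hypothesis eta1 : forall x y : nat -> K, (forall m n, x m < y n) ->
  exists z, forall n, x n < z < y n.

Let bounded_nat (r : nat -> K) : exists B, forall n, `|r n| < B.
Proof.
have pos n : 0 < 1 + `|r n| by rewrite ltr_pwDl.
(* A positive element below all the inverses has an inverse above all the terms. *)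
have [|z hz] := eta1 (x := fun=> 0) (y := fun n => (1 + `|r n|)^-1).
  by move=> _ n; rewrite invr_gt0.
exists z^-1 => n; have /andP[z0 zr] := hz n.
apply: (@lt_trans _ _ (1 + `|r n|)); first by rewrite ltrDr.
by rewrite -[ltLHS]invrK ltf_pV2 ?posrE ?invr_gt0.
Qed.

(* An ultrafilter containing all the [T n] decides on which side of each break
   point to look; a point on the right side of all of them is in every [T n]. *)
Lemma tame_bigcap_nonempty (T : nat -> set K) :
  (forall n, tame (T n)) -> (forall n, T n !=set0) ->
  (forall m n, (m <= n)%N -> T n `<=` T m) -> exists x, forall n, T n x.
Proof.
move=> tT nT dT; have /choice[rs hrs] := tT.
have FF : Filter (filter_from setT T).
  apply: filter_from_filter; first by exists 0%N.
  move=> m n _ _; exists (maxn m n) => // x Tx.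
  by split; apply: dT Tx; rewrite ?leq_maxl ?leq_maxr.
have FP := filter_from_proper FF (fun n _ => nT n).
have [G [GU FG]] := ultraFilterLemma FP.
have GT n : G (T n) by apply: FG; exists n.
pose r n := if unpickle n is Some (i, j) then nth 0 (rs i) j else 0.
have rP i c : c \in rs i -> exists n, r n = c.
  by move=> ci; exists (pickle (i, index c (rs i))); rewrite /r pickleK nth_index.
have [[c Gc]|nG] := pselect (exists c, G [set c]).
  by exists c => n; have [x [<-]] := filter_ex (filterI Gc (GT n)).
have side c : G [set x | c < x] \/ G [set x | x < c].
  have [h|h] := in_ultra_setVsetC [set x | c < x] GU; [by left|right].
  have [h'|h'] := in_ultra_setVsetC [set c] GU; first by case: nG; exists c.
  apply: filterS2 h h' => x /= /negP; rewrite -leNgt => xc /eqP xc'.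
  by rewrite lt_neqAle xc'.
have [B hB] := bounded_nat r.
(* The break points to the left and right of the ultrafilter form the two sides of a cut; [- B] and
   [B], beyond all break points, replace the remaining terms. *)
pose X n := if `[< G [set x | r n < x] >] then r n else - B.
pose Y n := if `[< G [set x | x < r n] >] then r n else B.
have [m n|z hz] := eta1 (x := X) (y := Y).
  have rB i : r i < B := le_lt_trans (ler_norm _) (hB i).
  have Br i : - B < r i.
    by rewrite ltrNl; apply: le_lt_trans (hB i); rewrite -normrN ler_norm.
  rewrite /X /Y; case: asboolP => [h1|_]; case: asboolP => [h2|_] //.
    by have [x [h3 h4]] := filter_ex (filterI h1 h2); exact: lt_trans h4.
  exact: lt_trans (Br 0%N) (rB 0%N).
exists z => n.
(* It suffices to find in [T n] a point that no break point of [T n] separates from [z]. There are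
   finitely many of them, so [G] contains the set of points on the right side of all. *)
suff [x [Tx hx]] : exists x, T n x /\
    forall c, c \in rs n -> c < x /\ c < z \/ x < c /\ z < c.
  have [->//|xz] := eqVneq z x.
  have hc c : c \in rs n -> ~~ (Order.min x z <= c <= Order.max x z).
    by move=> /hx[[cx cz]|[xc zc]]; rewrite ge_min le_max !leNgt ?cx ?cz ?xc ?zc ?andbF.
  have [zx|xz'|e] := ltgtP z x; last by rewrite e eqxx in xz.
    by apply/(hrs n z x zx) => // c /hc; rewrite minC min_l ?max_l // ltW.
  by apply/(hrs n x z xz') => // c /hc; rewrite min_l ?max_r // ltW.
suff : forall s : seq K, {subset s <= rs n} ->
    G [set x | forall c, c \in s -> c < x /\ c < z \/ x < c /\ z < c].
  move=> /(_ (rs n)) h; have [//|x [Tx hx]] := filter_ex (filterI (GT n) (h _)).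
  by exists x.
elim=> [_|c s IH sub]; first by apply: filterE => x c.
have [i ri] := rP n c (sub c (mem_head _ _)).
have Gs := IH (fun c cs => sub c (mem_behead (s := _ :: _) cs)).
have /andP[Xz zY] := hz i.
have [Gc|Gc] := side c.
  have cz : c < z by move: Xz; rewrite /X ri; case: asboolP.
  apply: filterS2 Gs Gc => x hs cx d; rewrite inE => /orP[/eqP ->|/hs//].
  by left.
have zc : z < c by move: zY; rewrite /Y ri; case: asboolP.
apply: filterS2 Gs Gc => x hs xc d; rewrite inE => /orP[/eqP ->|/hs//].
by right.
Qed.

End Tame.

(** * Enumeration of the formulas over countably many parameters *)

Section Codes.
Variables (K : rcfType) (a : nat -> K).
Import GenTree.

(* Malformed codes are decoded arbitrarily. *)
Fixpoint decode_term (c : tree nat) : GRing.term K :=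
  match c with
  | Node 0 [:: Leaf n] => GRing.Var K n
  | Node 1 [:: Leaf n] => GRing.Const (a n)
  | Node 2 [:: Leaf n] => GRing.NatConst K n
  | Node 3 [:: c1; c2] => GRing.Add (decode_term c1) (decode_term c2)
  | Node 4 [:: c1] => GRing.Opp (decode_term c1)
  | Node 5 [:: c1; Leaf n] => GRing.NatMul (decode_term c1) n
  | Node 6 [:: c1; c2] => GRing.Mul (decode_term c1) (decode_term c2)
  | Node 7 [:: c1] => GRing.Inv (decode_term c1)
  | Node 8 [:: c1; Leaf n] => GRing.Exp (decode_term c1) n
  | _ => GRing.NatConst K 0
  end.

Fixpoint decode_formula (c : tree nat) : ord.formula K :=
  match c with
  | Node 0 [::] => ord.Bool true
  | Node 1 [::] => ord.Bool false
  | Node 2 [:: c1; c2] => ord.Equal (decode_term c1) (decode_term c2)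
  | Node 3 [:: c1; c2] => ord.Lt (decode_term c1) (decode_term c2)
  | Node 4 [:: c1; c2] => ord.Le (decode_term c1) (decode_term c2)
  | Node 5 [:: c1] => ord.Unit (decode_term c1)
  | Node 6 [:: c1; c2] => ord.And (decode_formula c1) (decode_formula c2)
  | Node 7 [:: c1; c2] => ord.Or (decode_formula c1) (decode_formula c2)
  | Node 8 [:: c1; c2] => ord.Implies (decode_formula c1) (decode_formula c2)
  | Node 9 [:: c1] => ord.Not (decode_formula c1)
  | Node 10 [:: Leaf n; c1] => ord.Exists n (decode_formula c1)
  | Node 11 [:: Leaf n; c1] => ord.Forall n (decode_formula c1)
  | _ => ord.Bool true
  end.

Lemma decode_term_surj (t : GRing.term K) :
  (forall x, x \in term_params t -> exists n, a n = x) ->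
  exists c, decode_term c = t.
Proof.
have sub2 (s1 s2 : seq K) (P : K -> Prop) : (forall x, x \in s1 ++ s2 -> P x) ->
    (forall x, x \in s1 -> P x) /\ (forall x, x \in s2 -> P x).
  by move=> h; split=> x xs; apply: h; rewrite mem_cat xs ?orbT.
elim: t => /=.
- by move=> n _; exists (Node 0 [:: Leaf n]).
- move=> x /(_ x (mem_head _ _))[n <-]; by exists (Node 1 [:: Leaf n]).
- by move=> n _; exists (Node 2 [:: Leaf n]).
- by move=> t IHt u IHu /sub2[/IHt[c <-] /IHu[d <-]]; exists (Node 3 [:: c; d]).
- by move=> t IHt /IHt[c <-]; exists (Node 4 [:: c]).
- by move=> t IHt n /IHt[c <-]; exists (Node 5 [:: c; Leaf n]).
- by move=> t IHt u IHu /sub2[/IHt[c <-] /IHu[d <-]]; exists (Node 6 [:: c; d]).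
- by move=> t IHt /IHt[c <-]; exists (Node 7 [:: c]).
- by move=> t IHt n /IHt[c <-]; exists (Node 8 [:: c; Leaf n]).
Qed.

Lemma decode_formula_surj (f : ord.formula K) :
  (forall x, x \in params f -> exists n, a n = x) ->
  exists c, decode_formula c = f.
Proof.
have sub2 (s1 s2 : seq K) (P : K -> Prop) : (forall x, x \in s1 ++ s2 -> P x) ->
    (forall x, x \in s1 -> P x) /\ (forall x, x \in s2 -> P x).
  by move=> h; split=> x xs; apply: h; rewrite mem_cat xs ?orbT.
elim: f => /=.
- by case=> _; [exists (Node 0 [::])|exists (Node 1 [::])].
- by move=> t u /sub2[/decode_term_surj[c <-] /decode_term_surj[d <-]];
    exists (Node 2 [:: c; d]).
- by move=> t u /sub2[/decode_term_surj[c <-] /decode_term_surj[d <-]];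
    exists (Node 3 [:: c; d]).
- by move=> t u /sub2[/decode_term_surj[c <-] /decode_term_surj[d <-]];
    exists (Node 4 [:: c; d]).
- by move=> t /decode_term_surj[c <-]; exists (Node 5 [:: c]).
- by move=> f IHf g IHg /sub2[/IHf[c <-] /IHg[d <-]]; exists (Node 6 [:: c; d]).
- by move=> f IHf g IHg /sub2[/IHf[c <-] /IHg[d <-]]; exists (Node 7 [:: c; d]).
- by move=> f IHf g IHg /sub2[/IHf[c <-] /IHg[d <-]]; exists (Node 8 [:: c; d]).
- by move=> f IHf /IHf[c <-]; exists (Node 9 [:: c]).
- by move=> n f IHf /IHf[c <-]; exists (Node 10 [:: Leaf n; c]).
- by move=> n f IHf /IHf[c <-]; exists (Node 11 [:: Leaf n; c]).
Qed.

End Codes.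

Lemma enum_formulas (K : rcfType) (A : set K) : countable A ->
  exists F : nat -> ord.formula K, forall f, (forall x, x \in params f -> A x) ->
    exists n, F n = f.
Proof.
move=> /countable_injP[g ginj].
pose a n := xget 0 [set x | A x /\ g x = n].
exists (fun n => decode_formula a (odflt (GenTree.Leaf 0%N) (unpickle n))) => f fA.
have [x /fA Ax|c cf] := @decode_formula_surj _ a f.
  exists (g x); rewrite /a; case: xgetP => [y _ [Ay gy]|/(_ x)[]//].
  by apply: ginj; rewrite ?inE.
by exists (pickle c); rewrite pickleK.
Qed.

(** The formulas of the type among the first [n] of an enumeration define a decreasing sequence of
    nonempty tame sets. *)
Lemma eta1_aleph1_saturated (K : rcfType) :
  (forall x y : nat -> K, (forall m n, x m < y n) ->
     exists z, forall n, x n < z < y n) -> aleph1_saturated K.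
Proof.
move=> eta1 A p cA pA pfin; have [F hF] := enum_formulas cA.
pose T n : set K := fun x => forall i, (i < n)%N -> p (F i) -> ord.holds [:: x] (F i).
have tT n : tame (T n).
  elim: n => [|n IH]; first by apply: tame_eq (tame_cst K True) _ => x; split.
  have tF : tame (fun x => p (F n) -> ord.holds [:: x] (F n)).
    have [pF|npF] := pselect (p (F n)).
      have [rF _ _] := pA _ pF.
      by apply: tame_eq (tame_formula rF) _ => x; tauto.
    by apply: tame_eq (tame_cst K True) _ => x; tauto.
  apply: tame_eq (@tame_comp2 K and _ _ _ IH tF) _; first by tauto.
  move=> x; split=> [[h1 h2] i|h]; last by split=> [i lin|]; apply: h => //; exact: ltnW.
  by rewrite ltnS leq_eqVlt => /orP[/eqP ->//|]; exact: h1.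
have nT n : T n !=set0.
  have [||x hx] := pfin [set f | p f /\ exists2 i, (i < n)%N & F i = f].
  - apply: (@sub_finite_set _ _ (F @` `I_n)).
      by move=> f [_ [i lin <-]]; exists i.
    exact/finite_image/finite_II.
  - by move=> f [].
  by exists x => i lin pF; apply: hx; split=> //; exists i.
have [|x hx] := tame_bigcap_nonempty eta1 tT nT.
  by move=> m n mn x Tx i im; apply: Tx; exact: leq_trans mn.
exists x => f pf; have [n nf] := hF f (fun c => let: And3 _ _ h := pA f pf in h c).
by rewrite -nf; apply: (hx n.+1) => //; rewrite nf.
Qed.

(** * Integer parts that are models of PA *)

Local Ltac rpred :=
  do ?[assumption | exact: rpred1 | apply: rpredB | apply: rpredD | apply: rpredM].

(** * Pell solutions in a discretely ordered subring *)

Section PellSequence.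
Variables (K : rcfType) (M : subringClosed K).
Hypothesis M_disc : forall m : K, m \in M -> ~ (0 < m < 1).
Variable a : K.
Hypotheses (Ma : a \in M) (a_inf : infinitely_large a).

Let a2 : 2 < a. Proof. exact: (a_inf 2). Qed.

(** The Pell equation is written without subtraction, to match its version in the language of
    arithmetic. *)
Definition pell (x y : K) :=
  [/\ x \in M, 0 <= x, y \in M, 0 <= y & x * x + y * y = a * a * (y * y) + 1].

Lemma discrete_eq0 m : m \in M -> 0 <= m -> m < 1 -> m = 0.
Proof.
move=> mM m0 m1; apply: contrapT => /eqP mn0; apply: (M_disc mM).
by rewrite lt0r mn0 m0.
Qed.

Lemma standard_of_le (n : nat) m : m \in M -> 0 <= m -> m <= n%:R ->
  exists j : nat, m = j%:R.
Proof.
elim: n m => [|n IH] m mM m0 mn.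
  by exists 0%N; apply/eqP; rewrite eq_le mn m0.
have [m1|m1] := ltP m 1; first by exists 0%N; exact: discrete_eq0.
have [||| j hj] := IH (m - 1).
- by rewrite rpredB ?rpred1.
- by rewrite subr_ge0.
- by rewrite lerBlDr natr1.
by exists j.+1; rewrite -natr1 -hj subrK.
Qed.

(** The solution is the [n]-th power of a + sqrt(a^2 - 1). The induction also carries [x] congruent
    to 1 modulo [a - 1], and bounds each step by the crude factor [a ^+ 3]. *)
Lemma pell_standard (n : nat) : exists x y q, [/\ pell x y, q \in M, 0 <= q,
  y = q * (a - 1) + n%:R & y <= a ^+ (3 * n)].
Proof.
suff [x [y [q [r [h [qM q0 yq] [rM r0 xr] [xn yn]]]]]] : exists x y q r,
    [/\ pell x y, [/\ q \in M, 0 <= q & y = q * (a - 1) + n%:R],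
        [/\ r \in M, 0 <= r & x = r * (a - 1) + 1]
      & x <= a ^+ (3 * n) /\ y <= a ^+ (3 * n)] by exists x, y, q.
have a2' := a2; have a0 : 0 < a by lra.
elim: n => [|n [x [y [q [r [[xM x0 yM y0 e] [qM q0 yq] [rM r0 xr] [xn yn]]]]]]].
  exists 1, 0, 0, 0; rewrite muln0 expr0 !mul0r; split; split => //;
    rewrite ?rpred1 ?rpred0 //; ring.
exists (a * x + (a * a - 1) * y), (x + a * y), (r + y + q), (x + (a + 1) * y + r).
have aa : 0 <= a * a - 1 by nra.
split; split.
- by rpred.
- by rewrite addr_ge0 ?mulr_ge0 // ltW.
- by rpred.
- by rewrite addr_ge0 ?mulr_ge0 // ltW.
- have -> : a * a * ((x + a * y) * (x + a * y)) + 1 =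
    (a * x + (a * a - 1) * y) * (a * x + (a * a - 1) * y)
    + (x + a * y) * (x + a * y) + (a * a * (y * y) + 1 - (x * x + y * y)) by ring.
  by rewrite e; ring.
- by rpred.
- by rewrite !addr_ge0.
- by rewrite -natr1 [in x + _]xr {1}yq; ring: yq.
- by rpred.
- by rewrite !addr_ge0 ?mulr_ge0 // addr_ge0 // ltW.
- by rewrite {1}xr; ring: xr.
- rewrite mulnS exprD; set A := a ^+ (3 * n) in xn yn *.
  have A0 : 0 < A by rewrite exprn_gt0.
  have h1 : a * x <= a * A by rewrite ler_pM2l.
  have h2 : (a * a - 1) * y <= (a * a - 1) * A by rewrite ler_wpM2l.
  have h3 : (a + a * a - 1) * A <= a ^+ 3 * A.
    by rewrite ler_pM2r // !exprS expr0; nra.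
  lra.
- rewrite mulnS exprD; set A := a ^+ (3 * n) in xn yn *.
  have A0 : 0 < A by rewrite exprn_gt0.
  have h1 : a * y <= a * A by rewrite ler_pM2l.
  have h3 : (1 + a) * A <= a ^+ 3 * A.
    by rewrite ler_pM2r // !exprS expr0; nra.
  lra.
Qed.

(** Multiplication by a - sqrt(a^2 - 1) divides [y] by at least [a], so at most [n] steps lead to
    [y = 0]; going back up, each step adds 1 to the residue of [y]. *)
Lemma pell_descent n x y : pell x y -> y < a ^+ n -> exists (j : nat) q r,
  [/\ q \in M, r \in M, y = q * (a - 1) + j%:R & x = r * (a - 1) + 1].
Proof.
have a2' := a2; have a0 : 0 < a by lra.
elim: n x y => [|n IH] x y [xM x0 yM y0 e] yn.
  have y00 := discrete_eq0 yM y0 yn; exists 0%N, 0, 0; split; rewrite ?rpred0 //.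
    by rewrite y00; ring.
  rewrite y00 !mulr0 addr0 add0r in e.
  rewrite mul0r add0r; apply/eqP; rewrite -(@eqrXn2 _ 2) // expr1n.
  by rewrite expr2 e.
have [y1|y1] := ltP y 1.
  apply: (IH x y) => //; rewrite (discrete_eq0 yM y0 y1) exprn_gt0 //.
have ys : 1 <= y * y by nra.
have exx : x * x = (a * a - 1) * (y * y) + 1 by move: e; lra.
have xay : x <= a * y.
  rewrite -ler_sqr ?nnegrE ?mulr_ge0 ?(ltW a0) // exprMn !expr2 exx; lra.
have tx : (a * a - 1) * y <= a * x.
  have t0 : 0 <= a * a - 1 by nra.
  have ts : 0 <= (a * a - 1) * (y * y) by rewrite mulr_ge0 // (le_trans ler01).
  rewrite -ler_sqr ?nnegrE ?mulr_ge0 ?(ltW a0) // !exprMn !expr2 exx.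
  move: t0 ts; set t := a * a - 1; set s := y * y => t0 ts.
  have -> : a * a = t + 1 by rewrite /t subrK.
  lra.
have x0' : 0 <= a * x - (a * a - 1) * y by rewrite subr_ge0.
have y0' : (a * y - x) * a <= y by lra.
have [||j [q [r [qM rM yq xr]]]] := IH (a * x - (a * a - 1) * y) (a * y - x).
- split.
  + by rpred.
  + by [].
  + by rpred.
  + by rewrite subr_ge0.
  + have -> : a * a * ((a * y - x) * (a * y - x)) + 1 =
      (a * x - (a * a - 1) * y) * (a * x - (a * a - 1) * y)
      + (a * y - x) * (a * y - x) + (a * a * (y * y) + 1 - (x * x + y * y)) by ring.
    by rewrite e; ring.
- by rewrite -(ltr_pM2r a0) -exprSr (le_lt_trans y0').
exists j.+1, (r + (a * y - x) + q), (a * x - (a * a - 1) * y + (a + 1) * (a * y - x) + r).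
split.
- by rpred.
- by rpred.
- by rewrite -natr1; lra.
- by lra.
Qed.

(** Below some power of [a] the residue of [y] modulo [a - 1] would also be a standard [j]. As
    [j < m < a - 1], the two quotients would differ by an element strictly between 0 and 1. *)
Lemma pell_large x y q m : pell x y -> q \in M -> m \in M ->
  y = q * (a - 1) + m -> infinitely_large m -> m < a - 1 -> forall n, a ^+ n <= y.
Proof.
move=> pxy qM mM yq minf ma n; rewrite leNgt; apply/negP => yn.
have [j [q' [r [q'M _ yq' _]]]] := pell_descent pxy yn.
have e : (q' - q) * (a - 1) = m - j%:R.
  by rewrite mulrBl -[q' * _](addrK j%:R) -yq' yq; ring.
apply: (M_disc (m := q' - q)); first by rewrite rpredB.
have a2' := a2; have a10 : 0 < a - 1 by lra.
apply/andP; split; first by rewrite -(pmulr_lgt0 _ a10) e subr_gt0.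
rewrite -(ltr_pM2r a10) e mul1r; have := ler0n K j; lra.
Qed.

End PellSequence.

(* Variables: 1 is an index [m], 2 is [y], 5 is the base [a]. *)
Definition pell_formula : arith_formula :=
  AExists 3 (AExists 4 (AAnd
    (AEqual (AAdd (AMul (AVar 3) (AVar 3)) (AMul (AVar 2) (AVar 2)))
       (AAdd (AMul (AMul (AVar 5) (AVar 5)) (AMul (AVar 2) (AVar 2))) AOne))
    (AEqual (AAdd (AVar 2) (AVar 4)) (AAdd (AMul (AVar 4) (AVar 5)) (AVar 1))))).

(** Variable 0 is the induction variable and 6 the bound [X]; adding one turns [<] into [<=]. *)
Definition bounded_formula : arith_formula :=
  AForall 1 (AImplies (ALt (AVar 1) (AAdd (AVar 0) AOne))
    (AExists 2 (AAnd (ALt (AVar 2) (AVar 6)) pell_formula))).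

Definition none_below_formula : arith_formula :=
  AForall 2 (AImplies (ALt (AVar 2) (AAdd (AVar 0) AOne)) (ANot pell_formula)).

(** * Induction inside the integer part: overspill and least solutions *)

Section PeanoIntegerPart.
Variables (K : rcfType) (M : subringClosed K).
Hypothesis M_disc : forall m : K, m \in M -> ~ (0 < m < 1).
Hypothesis M_PA : model_of_PA (nonneg_structure M).

Let N := nonneg_structure M.

Let elt (x : K) (xM : x \in M) (x0 : 0 <= x) : N :=
  exist _ x (introT andP (conj xM x0)).

Let valM (x : N) : val x \in M. Proof. by case: x => x /= /andP[]. Qed.
Let val_ge0 (x : N) : 0 <= val x. Proof. by case: x => x /= /andP[]. Qed.

(** The second equation is [y = q * (a - 1) + m] freed of subtraction. The shape follows
    [pell_formula], so that satisfaction reduces to it by computation. *)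
Definition pell_index (a m y : N) := exists x q : N,
  plus (times x x) (times y y) =
    plus (times (times a a) (times y y)) (Defs.one N) /\
  plus y q = plus (times q a) m.

Lemma pell_indexP (a m y : N) : pell_index a m y <->
  exists x q, [/\ pell M (val a) x (val y), q \in M, 0 <= q
    & val y = q * (val a - 1) + val m].
Proof.
split=> [[x [q [/(congr1 val) /= e1 /(congr1 val) /= e2]]]|].
  exists (val x), (val q); split; rewrite ?valM ?val_ge0 //.
    by split; rewrite ?valM ?val_ge0.
  by rewrite mulrBr mulr1 addrAC -e2 addrK.
move=> [x [q [[xM x0 _ _ e] qM q0 yq]]].
exists (elt xM x0), (elt qM q0); split; apply: val_inj => //=.
by rewrite yq mulrBr mulr1 addrAC subrK.
Qed.

Lemma induction_on (P : N -> Prop) (f : arith_formula) (e : nat -> N) :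
  (forall x, arith_holds (update e 0 x) f <-> P x) ->
  P (Defs.zero N) -> (forall x, P x -> P (plus x (Defs.one N))) -> forall x, P x.
Proof.
move=> fP P0 PS x; apply/fP; apply: (PA_induction M_PA).
  exact/fP.
by move=> y /fP Py; apply/fP; exact: PS.
Qed.

Let env (b a X : N) (i : nat) : N :=
  match i with 1 => b | 5 => a | 6 => X | _ => Defs.zero N end.

(** Otherwise [P] would hold exactly at the standard elements; these are closed under successor, so
    induction would make [a] standard. *)
Lemma overspill (a X : N) : infinitely_large (val a) ->
  (forall (m : N) (n : nat), val m = n%:R ->
    exists y, val y < val X /\ pell_index a m y) ->
  exists m : N, infinitely_large (val m) /\
    forall m' : N, val m' <= val m -> exists y, val y < val X /\ pell_index a m' y.
Proof.
move=> ainf std; pose P (x : N) := forall m' : N, val m' < val x + 1 ->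
  exists y : N, val y < val X /\ pell_index a m' y.
apply: contrapT => nh.
have Pstd (x : N) : P x -> exists n : nat, val x = n%:R.
  move=> Px; have [n xn] : exists n : nat, val x <= n%:R.
    apply: contrapT => nx; apply: nh; exists x; split.
      by move=> n; rewrite ltNge; apply/negP => xn; apply: nx; exists n.
    by move=> m' m'x; apply: Px; rewrite ltr_pwDr.
  by apply: (standard_of_le M_disc (n := n)).
have stdP (x : N) (n : nat) : val x = n%:R -> P x.
  move=> xn m' m'x; have [j m'j] : exists j : nat, val m' = j%:R.
    apply: (standard_of_le M_disc (n := n.+1)) => //.
    by rewrite -natr1 -xn ltW.
  exact: std m'j.
have Pall : forall x, P x.
  apply: (@induction_on P bounded_formula (env (Defs.zero N) a X)).
  - by [].
  - exact: (stdP _ 0%N).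
  - by move=> x /Pstd[n xn]; apply: (stdP _ n.+1); rewrite /= xn natr1.
have [n an] := Pstd a (Pall a).
by have := ainf n; rewrite an ltxx.
Qed.

(** Least number principle: without a least solution, induction shows that none lies at or below any
    [x]. *)
Lemma least_pell (a b : N) : (exists y, pell_index a b y) ->
  exists2 y, pell_index a b y & forall y', pell_index a b y' -> val y <= val y'.
Proof.
move=> [y0 hy0]; apply: contrapT => nh.
pose P (x : N) := forall y : N, val y < val x + 1 -> ~ pell_index a b y.
suff Pall : forall x, P x by apply: (Pall y0 y0) => //; rewrite ltrDl.
have least (y : N) : pell_index a b y ->
    ~ (forall y', pell_index a b y' -> val y <= val y').
  by move=> hy ley; apply: nh; exists y.
apply: (@induction_on P none_below_formula (env b a (Defs.zero N))).
- by [].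
- move=> y; rewrite /= add0r => y1 hy; apply: (least y hy) => y' _.
  by rewrite (discrete_eq0 M_disc (valM y)).
- move=> x Px y yx hy; apply: (least y hy) => y' hy'.
  have xy z : pell_index a b z -> val x + 1 <= val z.
    by move=> hz; rewrite leNgt; apply/negP => /Px.
  have yx0 : val y - (val x + 1) = 0.
    apply: (discrete_eq0 M_disc); first by rewrite !(rpredB, rpredD, rpred1) ?valM.
      by rewrite subr_ge0 xy.
    by rewrite ltrBlDl.
  by move/eqP: yx0; rewrite subr_eq0 => /eqP ->; exact: xy.
Qed.

End PeanoIntegerPart.

(** Let [e i] be the least solution whose index is an infinite element of [M] below [b i]; it
    exceeds all powers of [a]. An [X] in [M] above these powers and below every such [e i] would, by
    overspill, bound solutions of all indices up to an infinite one, hence some [e i]. *)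
Lemma not_PA_integer_part (I : Type) (K : rcfType) (b : I -> K) (a0 : K) :
  infinitely_large a0 ->
  (forall x, infinitely_large x -> exists i, infinitely_large (b i) /\ b i <= x) ->
  (forall (a : K) (s : I -> K), infinitely_large a -> exists z,
     (forall n, a ^+ n < z) /\ forall i, (forall n, a ^+ n < s i) -> z < s i) ->
  forall M : subringClosed K,
    integer_part M -> ~ model_of_PA (nonneg_structure M).
Proof.
move=> a0inf coinit noncoinit M [M_disc M_part] M_PA.
pose N := nonneg_structure M.
have vM (w : N) : val w \in M by case: w => w /= /andP[].
have lift x : x \in M -> 0 <= x -> exists y : N, val y = x.
  by move=> xM x0; exists (exist _ x (introT andP (conj xM x0))).
have infW (x y : K) : x <= y -> infinitely_large x -> infinitely_large y.
  by move=> xy xinf n; exact: lt_le_trans xy.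
have inf_sub1 (x y : K) : x - 1 <= y -> infinitely_large x -> infinitely_large y.
  move=> xy xinf; apply: infW xy _ => n.
  by rewrite ltrBrDr natr1.
have [a' a'M /andP[aa' a'a]] := M_part a0.
have a'inf : infinitely_large a' by exact: infW a0inf.
have [a av] := lift a' a'M (ltW (a'inf 0%N)).
rewrite -{a'}av in a'M aa' a'a a'inf.
have a2 : 2 < val a := a'inf 2.
have apos : 0 < val a := a'inf 0%N.
have /choice[e he] : forall i, exists ei : K, infinitely_large (b i) ->
    exists be : N, [/\ infinitely_large (val be), val be < val a - 1, val be <= b i &
      (exists y : N, pell_index a be y) ->
      (exists2 y : N, pell_index a be y & val y = ei) /\
      (forall y : N, pell_index a be y -> ei <= val y)].
  move=> i.
  have [binf|nb] := pselect (infinitely_large (b i)); last by exists 0.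
  (* The index must stay below [a - 1] for its residue to determine it. *)
  pose c := Num.min (b i) (val a / 2).
  have cinf : infinitely_large c.
    move=> n; rewrite lt_min binf ltr_pdivlMr //= -natrM; exact: a'inf.
  (* Rounding up [c - 1] gives an element of [M] below [c]. *)
  have [m mM /andP[cm mc]] := M_part (c - 1).
  rewrite subrK in mc.
  have minf : infinitely_large m by exact: inf_sub1 cinf.
  have [be bev] := lift m mM (ltW (minf 0%N)).
  have beinf : infinitely_large (val be) by rewrite bev.
  have be_b : val be <= b i by rewrite bev (le_trans (ltW mc)) // ge_min lexx.
  have be_a : val be < val a - 1.
    have h : m < val a / 2 by rewrite (lt_le_trans mc) // ge_min lexx orbT.
    by rewrite bev; lra.
  have [hex|nex] := pselect (exists y : N, pell_index a be y); last first.
    by exists 0 => _; exists be; split.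
  have [y hy ley] := least_pell M_disc M_PA hex.
  exists (val y) => _; exists be; split=> // _.
  by split; [exists y|exact: ley].
have [z [az ze]] := noncoinit (val a) e a'inf.
have powS n : val a ^+ n + 1 < val a ^+ n.+1.
  have h : 1 <= val a ^+ n by rewrite exprn_ege1 // ltW // (lt_trans _ a2) // ltr1n.
  rewrite exprS; have : 2 * val a ^+ n < val a * val a ^+ n by rewrite ltr_pM2r // (lt_le_trans _ h).
  lra.
have [X' X'M /andP[zX Xz]] := M_part (z - 1).
rewrite subrK in Xz.
have aX' n : val a ^+ n < X'.
  by have := az n.+1; have := powS n; lra.
have [X Xv] := lift X' X'M (ltW (lt_trans (exprn_gt0 0%N apos) (aX' 0%N))).
have [m [minf hm]] : exists m : N, infinitely_large (val m) /\
    forall m' : N, val m' <= val m -> exists y, val y < val X /\ pell_index a m' y.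
  apply: overspill => // m n mn.
  have [x [y [q [pxy qM q0 yq yn]]]] := pell_standard a'M a'inf n.
  have [xM x0 yM y0 _] := pxy; have [y' y'v] := lift y yM y0.
  exists y'; rewrite y'v Xv (le_lt_trans yn) //; split=> //.
  by apply/pell_indexP; exists x, q; rewrite y'v mn.
have [i [binf bm]] := coinit _ minf.
have [be [beinf be_a be_b hbe]] := he i binf.
have [y [yX hy]] := hm be (le_trans be_b bm).
have [[y' hy' y'e] ley] := hbe (ex_intro _ y hy).
have [x [q [pxy qM q0 yq]]] := (pell_indexP a be y').1 hy'.
have ae n : val a ^+ n < e i.
  rewrite -y'e; apply: lt_le_trans (pell_large M_disc a'M a'inf pxy qM _ yq beinf be_a n.+1).
    by have := powS n; lra.
  exact: vM.
have := ze i ae; have := ley y hy; rewrite Xv in yX; lra.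
Qed.

Theorem corollary1p4 :
  exists K : rcfType,
    aleph1_saturated K /\
    (forall M : subringClosed K,
       integer_part M -> ~ model_of_PA (nonneg_structure M)).
Proof.
have [I [K [eta1 [a ainf] [b bcoinit] noncoinit]]] := exists_asymmetric_rcf realalg.
exists K; split; first exact: eta1_aleph1_saturated.
exact: not_PA_integer_part ainf bcoinit noncoinit.
Qed.
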